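(* Let $m_1,\ldots,m_p$ be distinct positive integers, let $\gamma=\min_j m_j$, and for a positive integer $m$ let $\theta_m(x)=1/(x+m)$ for $x\in[0,1]$. For $s>0$ define $L_s:C[0,1]\to C[0,1]$ by $$(L_sv)(x)=\sum_{j=1}^p\big|\theta_{m_j}'(x)\big|^s\,v(\theta_{m_j}(x))=\sum_{j=1}^p (x+m_j)^{-2s}\,v\Big(\frac{1}{x+m_j}\Big).$$ Then for all $s>0$, $L_s$ has a strictly positive eigenvector $v_s$, unique up to positive scalar multiples, with $L_sv_s=\lambda_sv_s$, where $\lambda_s>0$ and $\lambda_s=r(L_s)$ is the spectral radius of $L_s$. The map $s\mapsto\lambda_s$ is strictly decreasing and continuous. For every positive integer $k$, $(-1)^kD^{(k)}v_s(x)>0$ for all $x\in[0,1]$ and $$|D^{(k)}v_s(x)|\le (2s)(2s+1)\cdots(2s+k-1)\,\gamma^{-k}\,v_s(x),\qquad x\in[0,1].$$ Finally, the Hausdorff dimension of the Cantor set $E_{[m_1,\ldots,m_p]}$ is the unique value of $s$ with $\lambda_s=1$.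
   Context: $E_{[m_1,\ldots,m_p]}$ denotes the set of points $x\in[0,1]$ whose continued fraction expansion $x=1/(a_1+1/(a_2+1/(a_3+\cdots)))$ has all coefficients $a_i\in\{m_1,\ldots,m_p\}$; equivalently it is the set of limit points of $\theta_{a_1}\circ\cdots\circ\theta_{a_n}(0)$ with all $a_i\in\{m_1,\ldots,m_p\}$. $D^{(k)}$ denotes the $k$-th derivative.
   Formalization: The final claim, that the Hausdorff dimension of E is the unique s with λ_s=1, is stated only for p≥2: for p=1, E is a single point and λ_s<1 for all s>0, so no such s exists. The spectral radius is taken as lim ‖L_s^n‖^{1/n}. *)

(* Defs.v *)
From Stdlib Require Import Reals Lra List.
From Coquelicot Require Import Coquelicot.
Open Scope R_scope.

Definition theta (mj : nat) (x : R) : R := / (x + INR mj).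

Definition Lop (m : list nat) (s : R) (v : R -> R) (x : R) : R :=
  fold_right (fun mj acc => Rpower (x + INR mj) (- (2 * s)) * v (theta mj x) + acc) 0 m.

Definition listmin (m : list nat) : nat :=
  match m with nil => 0%nat | a :: t => fold_right Nat.min a t end.

Definition cont01 (w : R -> R) : Prop :=
  forall x, 0 <= x <= 1 ->
    filterlim w (within (fun t => 0 <= t <= 1) (locally x)) (locally (w x)).

Definition opnorm (T : (R -> R) -> (R -> R)) : Rbar :=
  Rbar_lub (fun r => exists w x, cont01 w /\ (forall t, 0 <= t <= 1 -> Rabs (w t) <= 1)
                       /\ 0 <= x <= 1 /\ r = Finite (Rabs (T w x))).

(* r is the spectral radius of T (Gelfand's formula r = lim ||T^n||^(1/n)) *)
Definition is_spectral_radius (T : (R -> R) -> (R -> R)) (r : R) : Prop :=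
  is_lim_seq (fun n => Rpower (real (opnorm (Nat.iter (S n) T))) (/ INR (S n))) (Finite r).

Fixpoint rising (a : R) (k : nat) : R :=
  match k with O => 1 | S k' => rising a k' * (a + INR k') end.

Fixpoint comp_theta (a : nat -> nat) (n : nat) (y : R) : R :=
  match n with O => y | S n' => theta (a O) (comp_theta (fun i => a (S i)) n' y) end.

Definition cantorE (m : list nat) (x : R) : Prop :=
  exists a : nat -> nat, (forall i, In (a i) m) /\
    is_lim_seq (fun n => comp_theta a n 0) (Finite x).

Definition diam (U : R -> Prop) : R :=
  real (Lub_Rbar (fun d => exists x y, U x /\ U y /\ d = Rabs (x - y))).

(* d^s with convention 0^s = 0 (s > 0; also used for the empty set) *)
Definition dpow (d s : R) : R := if Rle_dec d 0 then 0 else Rpower d s.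

(* sum of a nonnegative series, in [0, +oo] *)
Definition rsum (f : nat -> R) : Rbar :=
  Rbar_lub (fun r => exists n, r = Finite (sum_n f n)).

Definition hausdorff_delta (s delta : R) (A : R -> Prop) : Rbar :=
  Rbar_glb (fun r => exists U : nat -> (R -> Prop),
     (forall x, A x -> exists i, U i x) /\
     (forall i x y, U i x -> U i y -> Rabs (x - y) <= delta) /\
     r = rsum (fun i => dpow (diam (U i)) s)).

Definition hausdorff_measure (s : R) (A : R -> Prop) : Rbar :=
  Rbar_lub (fun r => exists delta, 0 < delta /\ r = hausdorff_delta s delta A).

Definition hausdorff_dim (A : R -> Prop) : Rbar :=
  Rbar_glb (fun r => exists s, 0 < s /\ r = Finite s /\ hausdorff_measure s A = Finite 0).

(* Main.v *)
(* The kernel K(x, y) = (1 + x y)^(-2s) satisfies L_x K = L_y K.  Hence if nu is a positive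
   functional with nu (L f) = lam * nu f, then v(x) = nu (K(x, .)) is an eigenfunction for lam, and
   differentiating under nu gives (-1)^k D^k v(x) = (2s)...(2s+k-1) nu (y^k (1 + x y)^(-2s-k)), from
   which the sign and the bound are immediate, since nu only sees y <= 1/gamma.  The functional is
   nu f = lim (L^n f)(0) / (L^n 1)(0) on C^1 functions; the limit exists because L maps the cone
   |f'| <= 8s f / (1+x) into the narrower cone |f'| <= 6s f / (1+x).

   Comparing L_t v_s with v_s under nu_t shows that lam decreases strictly and continuously.  For the
   dimension, a word w with denominators (Q, Q') gets the weight Q^(-2s) v(Q'/Q), which is comparable
   to the s-th power of the diameter of its cylinder; the weights of the one-letter extensions of w
   add up to lam times its weight.  If lam < 1, the cylinders of length n are covers of arbitrarily
   small s-mass.  If lam >= 1, then for a cover of too small mass every cylinder that is covered too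
   lightly has a child with the same defect, and the resulting branch is a point which is not
   covered. *)

Require Import Defs.
From Stdlib Require Import Reals Lra Lia List ClassicalEpsilon.
From Coquelicot Require Import Coquelicot.
Open Scope R_scope.

(** The functional [nu] is obtained without compactness or measure theory. One application of [Lop]
    turns the cone constant B into 2s + B/2, whose fixed point is 4s. The constant 8s lies above it,
    and the slack between 8s and its image 6s lets a fixed proportion be peeled off at each step,
    which makes the ratios converge geometrically. Since [nu] is known only as a positive linear
    functional on C^1 functions, differentiation under it rests on a Taylor remainder that is
    uniform in y. The variable x ranges over x > -1/2, so that the derivatives at the endpoint 0 are
    two-sided. Uniqueness cannot use the cone, because a competing eigenfunction is only continuous.
    It follows from the extrema of the quotient, whose values are transported along an orbit to one
    common limit point. In the lower bound for the dimension the covering sets are arbitrary and are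
    not reduced to a finite open cover. Each set receives a small extra mass instead, so that a set
    containing the branch point cannot have mass 0. *)

(** * Finite sums, real powers and the maps [theta] *)

Definition lsum {A : Type} (l : list A) (F : A -> R) : R :=
  fold_right (fun a acc => F a + acc) 0 l.

Lemma lsum_ext {A : Type} (l : list A) (F G : A -> R) :
  (forall a, In a l -> F a = G a) -> lsum l F = lsum l G.
Proof.
  induction l as [|a l IH]; intros H; simpl; [easy|].
  rewrite (H a), IH; [easy| |now left]. intros; apply H; now right.
Qed.

Lemma lsum_le {A : Type} (l : list A) (F G : A -> R) :
  (forall a, In a l -> F a <= G a) -> lsum l F <= lsum l G.
Proof.
  induction l as [|a l IH]; intros H; simpl; [lra|].
  apply Rplus_le_compat; [apply H; now left|apply IH; intros; apply H; now right].
Qed.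

Lemma lsum_plus {A : Type} (l : list A) (F G : A -> R) :
  lsum l (fun a => F a + G a) = lsum l F + lsum l G.
Proof. induction l as [|a l IH]; simpl; [|rewrite IH]; ring. Qed.

Lemma lsum_scal {A : Type} (l : list A) (c : R) (F : A -> R) :
  lsum l (fun a => c * F a) = c * lsum l F.
Proof. induction l as [|a l IH]; simpl; [|rewrite IH]; ring. Qed.

Lemma lsum_nonneg {A : Type} (l : list A) (F : A -> R) :
  (forall a, In a l -> 0 <= F a) -> 0 <= lsum l F.
Proof.
  intros H. replace 0 with (lsum l (fun a => 0 * F a)) by (rewrite lsum_scal; ring).
  apply lsum_le. intros a Ha. rewrite Rmult_0_l. auto.
Qed.

Lemma lsum_ge_term {A : Type} (l : list A) (F : A -> R) (a : A) :
  In a l -> (forall b, In b l -> 0 <= F b) -> F a <= lsum l F.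
Proof.
  induction l as [|b l IH]; intros Ha H; simpl; [easy|].
  destruct Ha as [<-|Ha].
  - assert (0 <= lsum l F) by (apply lsum_nonneg; intros; apply H; now right). lra.
  - assert (F a <= lsum l F) by (apply IH; [easy|intros; apply H; now right]).
    assert (0 <= F b) by (apply H; now left). lra.
Qed.

Lemma lsum_abs {A : Type} (l : list A) (F : A -> R) :
  Rabs (lsum l F) <= lsum l (fun a => Rabs (F a)).
Proof.
  induction l as [|a l IH]; simpl; [rewrite Rabs_R0; lra|].
  eapply Rle_trans; [apply Rabs_triang|]. lra.
Qed.

Lemma is_derive_lsum {A : Type} (l : list A) (F : A -> R -> R) (dF : A -> R) (x : R) :
  (forall a, In a l -> is_derive (F a) x (dF a)) ->
  is_derive (fun t => lsum l (fun a => F a t)) x (lsum l dF).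
Proof.
  induction l as [|a l IH]; intros H; simpl.
  - apply @is_derive_const.
  - apply @is_derive_plus; [apply H; now left|apply IH; intros; apply H; now right].
Qed.

Lemma Rpower_pos (x y : R) : 0 < Rpower x y.
Proof. apply exp_pos. Qed.

Lemma Rpower_base_anti (a x y : R) :
  0 <= a -> 0 < x <= y -> Rpower y (- a) <= Rpower x (- a).
Proof.
  intros Ha Hxy. rewrite !Rpower_Ropp. apply Rinv_le_contravar; [apply Rpower_pos|].
  now apply Rle_Rpower_l.
Qed.

Lemma Rpower_ge_1 (a x : R) : 0 <= a -> 1 <= x -> 1 <= Rpower x a.
Proof.
  intros Ha Hx. apply Rle_trans with (Rpower x 0); [rewrite Rpower_O; lra|].
  apply Rle_Rpower; lra.
Qed.

Lemma Rpower_le_1 (a x : R) : 0 <= a -> 1 <= x -> Rpower x (- a) <= 1.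
Proof.
  intros Ha Hx. apply Rle_trans with (Rpower x 0); [|rewrite Rpower_O; lra].
  apply Rle_Rpower; lra.
Qed.

Lemma is_derive_Rpower_affine (a b c x : R) :
  0 < a + b * x ->
  is_derive (fun t => Rpower (a + b * t) c) x (b * (c * Rpower (a + b * x) (c - 1))).
Proof.
  intros H. apply (is_derive_comp (fun u => Rpower u c) (fun t => a + b * t)).
  - apply is_derive_Reals. now apply derivable_pt_lim_power.
  - auto_derive; [easy|ring].
Qed.

Lemma INR_ge_1 (k : nat) : (0 < k)%nat -> 1 <= INR k.
Proof. intros H. apply (le_INR 1). lia. Qed.

Lemma theta_bounds (j : nat) (x : R) : 1 <= INR j -> 0 <= x <= 1 -> 0 <= theta j x <= 1.
Proof.
  intros Hj Hx. unfold theta. split; [left; apply Rinv_0_lt_compat; lra|].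
  rewrite <- Rinv_1. apply Rinv_le_contravar; lra.
Qed.

Lemma is_derive_theta (j : nat) (x : R) :
  0 < x + INR j -> is_derive (theta j) x (- / (x + INR j) ^ 2).
Proof.
  intros H. unfold theta. auto_derive; [lra|]. field. lra.
Qed.

Lemma mvt_bound (f f' : R -> R) (a b : R) :
  (forall x, Rmin a b <= x <= Rmax a b -> is_derive f x (f' x)) ->
  exists c, Rmin a b <= c <= Rmax a b /\ f b - f a = f' c * (b - a).
Proof.
  intros H. apply (MVT_gen f a b f').
  - intros x Hx. apply H. lra.
  - intros x Hx. apply continuity_pt_filterlim.
    apply (ex_derive_continuous f x). exists (f' x). now apply H.
Qed.

(** * The transfer operator and its invariant cone *)

Section Transfer.

Context (m : list nat) (Hpos : forall k, In k m -> (0 < k)%nat) (Hne : m <> nil).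

Lemma letter_ge_1 (j : nat) : In j m -> 1 <= INR j.
Proof. intros H. now apply INR_ge_1, Hpos. Qed.

Lemma letter_bounded : exists M, 1 <= M /\ forall j, In j m -> INR j <= M.
Proof.
  clear. induction m as [|a l [M [H1 H2]]].
  - exists 1. split; [lra|easy].
  - exists (Rmax M (INR a)). split; [eapply Rle_trans; [apply H1|apply Rmax_l]|].
    intros j [<-|Hj]; [apply Rmax_r|]. eapply Rle_trans; [now apply H2|apply Rmax_l].
Qed.

Lemma Lop_linear (s a b : R) (f g : R -> R) (x : R) :
  Lop m s (fun y => a * f y + b * g y) x = a * Lop m s f x + b * Lop m s g x.
Proof.
  unfold Lop. clear. induction m as [|j l IH]; simpl; [|rewrite IH]; ring.
Qed.

Lemma Lop_le (s : R) (f g : R -> R) :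
  (forall x, 0 <= x <= 1 -> f x <= g x) ->
  forall x, 0 <= x <= 1 -> Lop m s f x <= Lop m s g x.
Proof.
  intros H x Hx. apply lsum_le. intros j Hj. apply Rmult_le_compat_l; [left; apply Rpower_pos|].
  apply H, theta_bounds; [now apply letter_ge_1|easy].
Qed.

Lemma Lop_ext (s : R) (f g : R -> R) :
  (forall x, 0 <= x <= 1 -> f x = g x) ->
  forall x, 0 <= x <= 1 -> Lop m s f x = Lop m s g x.
Proof.
  intros H x Hx. apply Rle_antisym; apply Lop_le; try easy; intros y Hy; rewrite (H y Hy); lra.
Qed.

Lemma Lop_nonneg (s : R) (f : R -> R) :
  (forall x, 0 <= x <= 1 -> 0 <= f x) -> forall x, 0 <= x <= 1 -> 0 <= Lop m s f x.
Proof.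
  intros H x Hx. apply lsum_nonneg. intros j Hj. apply Rmult_le_pos; [left; apply Rpower_pos|].
  apply H, theta_bounds; [now apply letter_ge_1|easy].
Qed.

Lemma Lop_pos (s : R) (f : R -> R) (x : R) :
  (forall j, In j m -> 0 < f (theta j x)) -> 0 < Lop m s f x.
Proof.
  intros H. destruct m as [|j l] eqn:E; [easy|]. rewrite <- E in *.
  assert (Hj : In j m) by (rewrite E; now left).
  apply Rlt_le_trans with (Rpower (x + INR j) (- (2 * s)) * f (theta j x)).
  - apply Rmult_lt_0_compat; [apply Rpower_pos|now apply H].
  - apply (lsum_ge_term m (fun j => Rpower (x + INR j) (- (2 * s)) * f (theta j x)) j Hj).
    intros i Hi. left. apply Rmult_lt_0_compat; [apply Rpower_pos|now apply H].
Qed.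

Lemma iter_Lop_le (s : R) (n : nat) (f g : R -> R) :
  (forall x, 0 <= x <= 1 -> f x <= g x) ->
  forall x, 0 <= x <= 1 -> Nat.iter n (Lop m s) f x <= Nat.iter n (Lop m s) g x.
Proof. intros H. induction n as [|n IH]; simpl; [easy|]. now apply Lop_le. Qed.

Lemma iter_Lop_linear (s : R) (n : nat) (a b : R) (f g : R -> R) (x : R) :
  Nat.iter n (Lop m s) (fun y => a * f y + b * g y) x
  = a * Nat.iter n (Lop m s) f x + b * Nat.iter n (Lop m s) g x.
Proof.
  revert x. induction n as [|n IH]; intros x; simpl; [easy|].
  rewrite <- Lop_linear. unfold Lop at 1 3.
  apply (lsum_ext m (fun j => _ * _) (fun j => _ * _)). intros j Hj. now rewrite IH.
Qed.

Lemma iter_Lop_pos (s : R) (n : nat) (x : R) :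
  0 <= x <= 1 -> 0 < Nat.iter n (Lop m s) (fun _ => 1) x.
Proof.
  revert x. induction n as [|n IH]; intros x Hx; simpl; [lra|].
  apply Lop_pos. intros j Hj. apply IH, theta_bounds; [now apply letter_ge_1|easy].
Qed.

(** The power is factored out of the product rule so that [cone_Lop] can compare this with
    [Lop m s f] letter by letter. *)
Definition Lop_deriv (s : R) (f f' : R -> R) (x : R) : R :=
  lsum m (fun j => Rpower (x + INR j) (- (2 * s)) *
    (- (2 * s) / (x + INR j) * f (theta j x) - / (x + INR j) ^ 2 * f' (theta j x))).

Lemma is_derive_Lop (s : R) (f f' : R -> R) :
  (forall x, 0 <= x <= 1 -> is_derive f x (f' x)) ->
  forall x, 0 <= x <= 1 -> is_derive (Lop m s f) x (Lop_deriv s f f' x).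
Proof.
  intros H x Hx.
  apply (is_derive_lsum m (fun j t => Rpower (t + INR j) (- (2 * s)) * f (theta j t))).
  intros j Hj. pose proof (letter_ge_1 j Hj) as H1.
  evar_last.
  - apply (is_derive_mult (fun t => Rpower (t + INR j) (- (2 * s))) (fun t => f (theta j t)));
      [| |intros; apply Rmult_comm].
    + apply (is_derive_ext (fun t => Rpower (INR j + 1 * t) (- (2 * s)))).
      { intros t. f_equal. ring. }
      apply is_derive_Rpower_affine. lra.
    + apply (is_derive_comp f (theta j)).
      * apply H, theta_bounds; easy.
      * apply is_derive_theta. lra.
  - unfold plus, mult, scal; simpl. unfold mult; simpl.
    replace (INR j + 1 * x) with (x + INR j) by ring.
    unfold Rminus at 1. rewrite Rpower_plus, (Rpower_Ropp _ 1), Rpower_1 by lra. field. lra.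
Qed.

(* The weight [1 / (1 + x)] makes every [theta j] contract derivatives by a factor 2, although
   [theta 1] has derivative -1 at 0. *)
Definition cone (B : R) (f : R -> R) : Prop :=
  exists f' : R -> R, forall x, 0 <= x <= 1 ->
    is_derive f x (f' x) /\ 0 <= f x /\ Rabs (f' x) <= B / (1 + x) * f x.

Lemma cone_nonneg (B : R) (f : R -> R) (x : R) : cone B f -> 0 <= x <= 1 -> 0 <= f x.
Proof. intros [f' H] Hx. now destruct (H x Hx) as (_ & H1 & _). Qed.

Lemma cone_ext (B : R) (f g : R -> R) : (forall x, f x = g x) -> cone B f -> cone B g.
Proof.
  intros E [f' H]. exists f'. intros x Hx. destruct (H x Hx) as (H1 & H2 & H3).
  rewrite <- (E x). split; [|now split]. now apply (is_derive_ext f g x (f' x) E).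
Qed.

Lemma cone_mono (B C : R) (f : R -> R) : B <= C -> cone B f -> cone C f.
Proof.
  intros E [f' H]. exists f'. intros x Hx. destruct (H x Hx) as (H1 & H2 & H3).
  split; [easy|split; [easy|]]. eapply Rle_trans; [apply H3|].
  apply Rmult_le_compat_r; [easy|]. apply Rmult_le_compat_r; [|easy].
  left; apply Rinv_0_lt_compat; lra.
Qed.

(** The derivative of f - t g is at most B / (1 + x) times f + t g, and f >= c t g gives (c - 1) (f
    + t g) <= (c + 1) (f - t g). The price of subtracting is thus the factor (c + 1) / (c - 1) in
    the cone constant. With c = 7 it takes 6s exactly to 8s. *)
Lemma cone_sub (B C c t : R) (f g : R -> R) :
  0 <= t -> B * (c + 1) <= C * (c - 1) -> 0 <= B -> 0 <= C ->
  cone B f -> cone B g -> 1 <= c -> (forall x, 0 <= x <= 1 -> c * (t * g x) <= f x) ->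
  cone C (fun x => f x - t * g x).
Proof.
  intros Ht HBC HB HC [f' Hf] [g' Hg] Hc H. exists (fun x => f' x - t * g' x). intros x Hx.
  destruct (Hf x Hx) as (F1 & F2 & F3), (Hg x Hx) as (G1 & G2 & G3). specialize (H x Hx).
  assert (Htg : 0 <= t * g x) by now apply Rmult_le_pos.
  split; [|split].
  - apply (is_derive_minus f (fun x => t * g x)); [easy|]. now apply is_derive_scal.
  - nra.
  - eapply Rle_trans with (B / (1 + x) * (f x + t * g x)).
    + unfold Rminus. eapply Rle_trans; [apply Rabs_triang|].
      rewrite Rabs_Ropp, Rabs_mult, (Rabs_pos_eq t) by easy.
      assert (t * Rabs (g' x) <= t * (B / (1 + x) * g x)) by now apply Rmult_le_compat_l.
      lra.
    + unfold Rdiv. rewrite !(Rmult_comm _ (/ (1 + x))), !Rmult_assoc.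
      apply Rmult_le_compat_l; [left; apply Rinv_0_lt_compat; lra|].
      assert (B <= C) by nra.
      assert (0 <= (C - B) * (f x - c * (t * g x))) by (apply Rmult_le_pos; lra).
      assert (0 <= (C * (c - 1) - B * (c + 1)) * (t * g x)) by (apply Rmult_le_pos; lra).
      nra.
Qed.

(** The logarithmic derivative of the weight contributes 2s / (x + j) <= 2s / (1 + x). The chain
    rule contributes B / ((x + j) (x + j + 1)), and x + j + 1 >= 2 gains the factor 1/2. *)
Lemma cone_Lop (s B : R) (f : R -> R) :
  0 < s -> 0 <= B -> cone B f -> cone (2 * s + B / 2) (Lop m s f).
Proof.
  intros Hs HB [f' H]. exists (Lop_deriv s f f'). intros x Hx. split; [|split].
  - apply is_derive_Lop; [|easy]. intros y Hy. now apply H.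
  - apply Lop_nonneg; [|easy]. intros y Hy. now apply H.
  - unfold Lop_deriv. eapply Rle_trans; [apply lsum_abs|].
    change (Lop m s f x) with (lsum m (fun j => Rpower (x + INR j) (- (2 * s)) * f (theta j x))).
    rewrite <- lsum_scal. apply lsum_le. intros j Hj.
    pose proof (letter_ge_1 j Hj) as H1. pose proof (theta_bounds j x H1 Hx) as Ht.
    destruct (H _ Ht) as (_ & F1 & F2).
    rewrite Rabs_mult, (Rabs_pos_eq (Rpower _ _)) by (left; apply Rpower_pos).
    rewrite (Rmult_comm ((2 * s + B / 2) / (1 + x))), Rmult_assoc.
    apply Rmult_le_compat_l; [left; apply Rpower_pos|].
    unfold Rminus. eapply Rle_trans; [apply Rabs_triang|].
    assert (P : 0 < / (x + INR j)) by (apply Rinv_0_lt_compat; lra).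
    rewrite Rabs_Ropp, !Rabs_mult, (Rabs_pos_eq (f _)), (Rabs_pos_eq (/ _)) by
      (easy || (left; apply Rinv_0_lt_compat, pow_lt; lra)).
    rewrite Rabs_left by (unfold Rdiv; nra).
    apply Rle_trans with (2 * s / (x + INR j) * f (theta j x)
       + / (x + INR j) ^ 2 * (B / (1 + theta j x) * f (theta j x))).
    { apply Rplus_le_compat; [right; unfold Rdiv; ring|].
      apply Rmult_le_compat_l; [left; apply Rinv_0_lt_compat, pow_lt; lra|easy]. }
    rewrite <- Rmult_assoc, <- Rmult_plus_distr_r, (Rmult_comm (f _)).
    apply Rmult_le_compat_r; [easy|].
    replace (/ (x + INR j) ^ 2 * (B / (1 + theta j x)))
      with (B * (/ (x + INR j) * / (x + INR j + 1))) by (unfold theta; field; lra).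
    replace ((2 * s + B / 2) / (1 + x)) with (2 * s / (1 + x) + B * (/ (1 + x) * / 2))
      by (field; lra).
    assert (/ (x + INR j) <= / (1 + x)) by (apply Rinv_le_contravar; lra).
    apply Rplus_le_compat.
    + apply Rmult_le_compat_l; [lra|easy].
    + apply Rmult_le_compat_l; [easy|]. apply Rmult_le_compat; [lra| |easy|].
      * left; apply Rinv_0_lt_compat; lra.
      * apply Rinv_le_contravar; lra.
Qed.

(** Integrated form of the cone condition: f (1 + x)^B is nondecreasing and f (1 + x)^(-B) is
    nonincreasing. The leading factor [c] carries the sign, so that one statement covers both. *)
Lemma cone_weighted_mono (B c x y : R) (f : R -> R) :
  0 <= B -> (c = B \/ c = - B) -> cone B f -> 0 <= x <= y -> y <= 1 ->
  0 <= c * (f y * Rpower (1 + y) c - f x * Rpower (1 + x) c).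
Proof.
  intros HB Hc [f' H] Hxy Hy.
  destruct (mvt_bound (fun t => f t * Rpower (1 + t) c)
     (fun t => f' t * Rpower (1 + t) c + f t * (1 * (c * Rpower (1 + t) (c - 1)))) x y)
    as (z & Hz & E).
  - intros t Ht. rewrite Rmin_left, Rmax_right in Ht by lra.
    apply (is_derive_mult f (fun t => Rpower (1 + t) c)); [apply H; lra| |intros; apply Rmult_comm].
    apply (is_derive_ext (fun t => Rpower (1 + 1 * t) c)).
    { intros u. f_equal. ring. }
    replace (1 + t) with (1 + 1 * t) by ring. apply is_derive_Rpower_affine. lra.
  - rewrite Rmin_left, Rmax_right in Hz by lra. rewrite E.
    assert (Hz1 : 0 <= z <= 1) by lra. destruct (H z Hz1) as (_ & F1 & F2).
    unfold Rminus at 1. rewrite Rpower_plus, Rpower_Ropp, Rpower_1 by lra.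
    replace (c * ((f' z * Rpower (1 + z) c + f z * (1 * (c * (Rpower (1 + z) c * / (1 + z)))))
                  * (y - x)))
      with (Rpower (1 + z) c * (y - x) * (c * f' z + c * c / (1 + z) * f z)) by (field; lra).
    apply Rmult_le_pos; [apply Rmult_le_pos; [left; apply Rpower_pos|lra]|].
    assert (Rabs (c * f' z) <= c * c / (1 + z) * f z).
    { rewrite Rabs_mult.
      apply Rle_trans with (Rabs c * (B / (1 + z) * f z)).
      { apply Rmult_le_compat_l; [apply Rabs_pos|easy]. }
      right. destruct Hc as [->| ->]; rewrite ?Rabs_Ropp, Rabs_pos_eq by easy; field; lra. }
    pose proof (Rcomplements.Rabs_le_between (c * f' z) (c * c / (1 + z) * f z)). lra.
Qed.

(** Harnack inequality: depending on the order of x and y, one of the two monotone quantities bounds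
    f x / f y by a ratio of values of (1 + t)^B, which lie between 1 and 2^B. *)
Lemma cone_harnack (B x y : R) (f : R -> R) :
  0 < B -> cone B f -> 0 <= x <= 1 -> 0 <= y <= 1 -> f x <= Rpower 2 B * f y.
Proof.
  intros HB Hf Hx Hy.
  pose proof (cone_nonneg B f x Hf Hx) as Fx. pose proof (cone_nonneg B f y Hf Hy) as Fy.
  assert (P1 : forall t, 0 <= t <= 1 -> 1 <= Rpower (1 + t) B <= Rpower 2 B).
  { intros t Ht. split; [|apply Rle_Rpower_l; lra].
    apply Rpower_ge_1; lra. }
  pose proof (P1 x Hx). pose proof (P1 y Hy).
  destruct (Rle_or_lt x y) as [L|L].
  - pose proof (cone_weighted_mono B B x y f (Rlt_le _ _ HB) (or_introl eq_refl) Hf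
                  (conj (proj1 Hx) L) (proj2 Hy)) as Q.
    assert (f x * Rpower (1 + x) B <= f y * Rpower (1 + y) B).
    { apply (Rmult_le_reg_l B); lra. }
    assert (f x * 1 <= f x * Rpower (1 + x) B) by (apply Rmult_le_compat_l; lra).
    assert (f y * Rpower (1 + y) B <= f y * Rpower 2 B) by (apply Rmult_le_compat_l; lra).
    lra.
  - assert (L' : 0 <= y <= x) by lra.
    pose proof (cone_weighted_mono B (- B) y x f (Rlt_le _ _ HB) (or_intror eq_refl) Hf
                  L' (proj2 Hx)) as Q.
    rewrite !Rpower_Ropp in Q.
    assert (Q' : f x * / Rpower (1 + x) B <= f y * / Rpower (1 + y) B) by (apply (Rmult_le_reg_l B); lra).
    assert (f y * / Rpower (1 + y) B <= f y).
    { rewrite <- (Rmult_1_r (f y)) at 2. apply Rmult_le_compat_l; [easy|].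
      assert (/ Rpower (1 + y) B <= / 1) by (apply Rinv_le_contravar; lra). lra. }
    assert (Q2 : f x * / Rpower (1 + x) B * Rpower (1 + x) B <= f y * Rpower 2 B).
    { apply Rmult_le_compat; try lra. apply Rmult_le_pos; [easy|].
      left; apply Rinv_0_lt_compat; lra. }
    rewrite Rmult_assoc, Rinv_l in Q2 by lra. lra.
Qed.

(** * The conformal functional *)

Context (s : R) (Hs : 0 < s).

(** One factor 2^(8s) pays for the Harnack inequality of each of the two functions compared in
    [cone_peel]; the 7 is the ratio that [cone_sub] requires to pass from 6s to 8s. *)
Definition contraction_rate : R := / (7 * (Rpower 2 (8 * s) * Rpower 2 (8 * s))).

Lemma contraction_rate_bounds : 0 < contraction_rate < 1.
Proof.
  assert (1 <= Rpower 2 (8 * s)) by (apply Rpower_ge_1; lra).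
  unfold contraction_rate. split; [apply Rinv_0_lt_compat; nra|].
  rewrite <- Rinv_1. apply Rinv_lt_contravar; nra.
Qed.

(** With K = 2^(8s), Harnack gives L f >= L f (0) / K and L g <= K L g (0), so the subtracted
    multiple of L g is at most L f / 7. Both images lie in the cone for 6s, and [cone_sub] returns
    the difference to the cone for 8s. *)
Lemma cone_peel (f g : R -> R) :
  cone (8 * s) f -> cone (8 * s) g -> 0 < Lop m s g 0 ->
  cone (8 * s) (fun x => Lop m s f x
     - contraction_rate * Lop m s f 0 / Lop m s g 0 * Lop m s g x).
Proof.
  intros Hf Hg H0.
  assert (Cf : cone (6 * s) (Lop m s f)).
  { replace (6 * s) with (2 * s + 8 * s / 2) by field. apply cone_Lop; [easy|lra|easy]. }
  assert (Cg : cone (6 * s) (Lop m s g)).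
  { replace (6 * s) with (2 * s + 8 * s / 2) by field. apply cone_Lop; [easy|lra|easy]. }
  assert (Z : 0 <= 0 <= 1) by lra.
  pose proof (cone_nonneg _ _ 0 Cf Z) as Pf.
  pose proof contraction_rate_bounds as [Hc _].
  set (K := Rpower 2 (8 * s)) in *.
  assert (HK : 1 <= K) by (apply Rpower_ge_1; lra).
  apply (cone_sub (6 * s) (8 * s) 7); try lra; [|easy|easy|].
  - apply Rmult_le_pos; [apply Rmult_le_pos; lra|left; now apply Rinv_0_lt_compat].
  - intros x Hx.
    assert (HKf : Lop m s f 0 <= K * Lop m s f x).
    { apply cone_harnack; [lra| |easy|easy]. apply (cone_mono (6 * s)); [lra|easy]. }
    assert (HKg : Lop m s g x <= K * Lop m s g 0).
    { apply cone_harnack; [lra| |easy|easy]. apply (cone_mono (6 * s)); [lra|easy]. }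
    apply Rle_trans with (Lop m s f 0 / K * (Lop m s g x / (K * Lop m s g 0))).
    + right. unfold contraction_rate. fold K. field. split; lra.
    + pose proof (cone_nonneg _ _ x Cg Hx).
      assert (Lop m s g x / (K * Lop m s g 0) <= 1).
      { apply Rle_div_l; nra. }
      assert (0 <= Lop m s g x / (K * Lop m s g 0)).
      { apply Rmult_le_pos; [easy|]. left; apply Rinv_0_lt_compat; nra. }
      assert (Lop m s f 0 / K <= Lop m s f x) by (apply Rle_div_l; lra).
      assert (0 <= Lop m s f 0 / K).
      { apply Rmult_le_pos; [easy|]. left; apply Rinv_0_lt_compat; lra. }
      nra.
Qed.

(** A step of Birkhoff's contraction: f lies between a g and b g in the order of the cone. Peeling
    both differences at the same value h = L f (0) / L g (0) moves a up by rate (h - a) and b down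
    by rate (b - h), so h cancels in the new length. *)
Lemma cone_pinch (f g : R -> R) (a b : R) :
  cone (8 * s) g -> 0 < Lop m s g 0 ->
  cone (8 * s) (fun x => f x - a * g x) -> cone (8 * s) (fun x => b * g x - f x) ->
  exists a' b', b' - a' = (1 - contraction_rate) * (b - a) /\
    cone (8 * s) (fun x => Lop m s f x - a' * Lop m s g x) /\
    cone (8 * s) (fun x => b' * Lop m s g x - Lop m s f x).
Proof.
  intros Hg H0 Ha Hb.
  pose proof (cone_peel _ _ Ha Hg H0) as Pa. pose proof (cone_peel _ _ Hb Hg H0) as Pb.
  assert (Ea : forall x, Lop m s (fun x => f x - a * g x) x = Lop m s f x - a * Lop m s g x).
  { intros x. replace (Lop m s f x - a * Lop m s g x)
      with (1 * Lop m s f x + (- a) * Lop m s g x) by ring.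
    rewrite <- Lop_linear. unfold Lop. apply (lsum_ext m (fun j => _ * _) (fun j => _ * _)).
    intros; f_equal; ring. }
  assert (Eb : forall x, Lop m s (fun x => b * g x - f x) x = b * Lop m s g x - Lop m s f x).
  { intros x. replace (b * Lop m s g x - Lop m s f x)
      with (b * Lop m s g x + (- 1) * Lop m s f x) by ring.
    rewrite <- Lop_linear. unfold Lop. apply (lsum_ext m (fun j => _ * _) (fun j => _ * _)).
    intros; f_equal; ring. }
  set (c := contraction_rate) in *. set (h := Lop m s f 0 / Lop m s g 0).
  exists (a + c * (h - a)), (b - c * (b - h)). split; [ring|]. split.
  - eapply cone_ext; [|apply Pa]. intros x. cbv beta. rewrite !Ea. unfold h. field. lra.
  - eapply cone_ext; [|apply Pb]. intros x. cbv beta. rewrite !Eb. unfold h. field. lra.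
Qed.

Definition c1_bounded (f : R -> R) : Prop :=
  exists (C : R) (f' : R -> R), forall x, 0 <= x <= 1 ->
    is_derive f x (f' x) /\ Rabs (f x) <= C /\ Rabs (f' x) <= C.

(** Adding a large constant puts any such function into the cone: the surplus C / (4s) is enough
    because 8s / (1 + x) >= 4s on [0,1]. The factor [1] is the function g from which [cone_pinch] is
    started. *)
Lemma c1_bounded_cone (f : R -> R) :
  c1_bounded f -> exists C, cone (8 * s) (fun x => f x - (- C) * 1) /\
                            cone (8 * s) (fun x => C * 1 - f x).
Proof.
  intros (C & f' & H). exists (C + C / (4 * s)).
  assert (D : forall x, 0 <= x <= 1 -> C <= 8 * s / (1 + x) * (C / (4 * s))).
  { intros x Hx. assert (Z : 0 <= 0 <= 1) by lra.
    destruct (H 0 Z) as (_ & HC & _). pose proof (Rabs_pos (f 0)).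
    replace (8 * s / (1 + x) * (C / (4 * s))) with (C * (2 * / (1 + x))) by (field; lra).
    assert (1 <= 2 * / (1 + x)).
    { apply (Rmult_le_reg_r (1 + x)); [lra|]. rewrite Rmult_assoc, Rinv_l; lra. }
    nra. }
  assert (P : forall x, 0 <= x <= 1 -> 0 < 8 * s / (1 + x)).
  { intros x Hx. apply Rdiv_lt_0_compat; lra. }
  assert (PC : forall x, 0 <= x <= 1 -> 0 <= C / (4 * s)).
  { intros x Hx. destruct (H x Hx) as (_ & HC & _). pose proof (Rabs_pos (f x)).
    apply Rmult_le_pos; [lra|]. left; apply Rinv_0_lt_compat; lra. }
  split.
  - exists f'. intros x Hx. destruct (H x Hx) as (F1 & F2 & F3).
    apply Rabs_le_between in F2. specialize (D x Hx). specialize (P x Hx). specialize (PC x Hx).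
    split; [|split; [lra|]].
    + evar_last; [apply (is_derive_minus f (fun _ => - (C + C / (4 * s)) * 1));
                    [apply F1|apply @is_derive_const]|].
      apply Rminus_0_r.
    + eapply Rle_trans; [apply F3|]. eapply Rle_trans; [apply D|].
      apply Rmult_le_compat_l; lra.
  - exists (fun x => - f' x). intros x Hx. destruct (H x Hx) as (F1 & F2 & F3).
    apply Rabs_le_between in F2. specialize (D x Hx). specialize (P x Hx). specialize (PC x Hx).
    split; [|split; [lra|]].
    + evar_last; [apply (is_derive_minus (fun _ => (C + C / (4 * s)) * 1) f);
                    [apply @is_derive_const|apply F1]|].
      apply Rminus_0_l.
    + rewrite Rabs_Ropp. eapply Rle_trans; [apply F3|]. eapply Rle_trans; [apply D|].
      apply Rmult_le_compat_l; lra.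
Qed.

Lemma cone_iter_one (n : nat) : cone (8 * s) (Nat.iter n (Lop m s) (fun _ => 1)).
Proof.
  induction n as [|n IH]; simpl.
  - exists (fun _ => 0). intros x Hx. split; [apply @is_derive_const|]. split; [lra|].
    rewrite Rabs_R0. left. rewrite Rmult_1_r. apply Rdiv_lt_0_compat; lra.
  - apply (cone_mono (2 * s + 8 * s / 2)); [lra|]. apply cone_Lop; [easy|lra|easy].
Qed.

(** The n-th interval traps not only the n-th ratio but all later ones, which is the Cauchy property
    that [nu_lim] needs. *)
Lemma cone_pinch_iter (f : R -> R) :
  c1_bounded f -> exists C, forall n, exists a b,
    b - a = (1 - contraction_rate) ^ n * C /\
    forall k, a <= Nat.iter (n + k) (Lop m s) f 0 / Nat.iter (n + k) (Lop m s) (fun _ => 1) 0 <= b.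
Proof.
  intros Hf. destruct (c1_bounded_cone f Hf) as (C & H1 & H2). exists (2 * C).
  set (g := fun n => Nat.iter n (Lop m s) (fun _ : R => 1)).
  set (h := fun n => Nat.iter n (Lop m s) f).
  assert (Z : 0 <= 0 <= 1) by lra.
  assert (H : forall n, exists a b, b - a = (1 - contraction_rate) ^ n * (2 * C) /\
     cone (8 * s) (fun x => h n x - a * g n x) /\ cone (8 * s) (fun x => b * g n x - h n x)).
  { intros n. induction n as [|n (a & b & E & Ha & Hb)].
    - exists (- C), C. split; [simpl; ring|]. now split.
    - destruct (cone_pinch (h n) (g n) a b) as (a' & b' & E' & Ha' & Hb');
        [apply cone_iter_one|apply (iter_Lop_pos s (S n) 0 Z)|easy|easy|].
      exists a', b'. split; [rewrite E', E; simpl; ring|]. now split. }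
  intros n. destruct (H n) as (a & b & E & Ha & Hb). exists a, b. split; [easy|]. intros k.
  assert (P : 0 < g (n + k)%nat 0) by apply (iter_Lop_pos s (n + k) 0 Z).
  (* A linear inequality between the n-th iterates of f and of 1 survives all further iterations,
     because the operator is positive. *)
  assert (L : forall c1 c2, (forall x, 0 <= x <= 1 -> 0 <= c1 * h n x + c2 * g n x) ->
                0 <= c1 * h (n + k)%nat 0 + c2 * g (n + k)%nat 0).
  { intros c1 c2 Hc. assert (Hk : forall x, 0 <= x <= 1 ->
        0 <= c1 * h (n + k)%nat x + c2 * g (n + k)%nat x); [|now apply Hk].
    induction k as [|k IH]; [now rewrite Nat.add_0_r|].
    intros x Hx. replace (n + S k)%nat with (S (n + k)) by lia.
    unfold h, g. simpl. rewrite <- Lop_linear. apply Lop_nonneg; [|easy].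
    apply IH. apply (iter_Lop_pos s (n + k) 0 Z). }
  change (a <= h (n + k)%nat 0 / g (n + k)%nat 0 <= b). split.
  - apply Rle_div_r; [easy|]. specialize (L 1 (- a)).
    enough (0 <= 1 * h (n + k)%nat 0 + - a * g (n + k)%nat 0) by lra.
    apply L. intros x Hx. pose proof (cone_nonneg _ _ x Ha Hx). simpl in *. lra.
  - apply Rle_div_l; [easy|]. specialize (L (- 1) b).
    enough (0 <= - 1 * h (n + k)%nat 0 + b * g (n + k)%nat 0) by lra.
    apply L. intros x Hx. pose proof (cone_nonneg _ _ x Hb Hx). simpl in *. lra.
Qed.

Definition ratio (f : R -> R) (n : nat) : R :=
  Nat.iter n (Lop m s) f 0 / Nat.iter n (Lop m s) (fun _ => 1) 0.

(** This stands in for integration against the conformal measure. [Lim_seq] is total, so the value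
    has its meaning only where [nu_lim] supplies convergence. *)
Definition nu (f : R -> R) : R := real (Lim_seq (ratio f)).

Lemma nu_lim (f : R -> R) : c1_bounded f -> is_lim_seq (ratio f) (nu f).
Proof.
  intros Hf. apply Lim_seq_correct', ex_lim_seq_cauchy_corr.
  destruct (cone_pinch_iter f Hf) as (C & H). intros eps.
  pose proof contraction_rate_bounds as Hc.
  assert (G : is_lim_seq (fun n => (1 - contraction_rate) ^ n * C) (0 * C)).
  { apply is_lim_seq_mult'; [|apply is_lim_seq_const]. apply is_lim_seq_geom.
    rewrite Rabs_pos_eq; lra. }
  rewrite Rmult_0_l in G. apply is_lim_seq_spec in G. destruct (G eps) as (N & HN).
  destruct (H N) as (a & b & E & Hab). exists N. intros n p Hn Hp.
  specialize (HN N (Nat.le_refl N)). rewrite <- E, Rminus_0_r in HN.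
  pose proof (Hab (n - N)%nat) as Bn. pose proof (Hab (p - N)%nat) as Bp.
  replace (N + (n - N))%nat with n in Bn by lia. replace (N + (p - N))%nat with p in Bp by lia.
  fold (ratio f n) in Bn. fold (ratio f p) in Bp.
  apply Rabs_lt_between in HN. apply Rabs_lt_between. lra.
Qed.

Lemma nu_eq (f : R -> R) (l : R) : is_lim_seq (ratio f) l -> nu f = l.
Proof. intros H. unfold nu. now rewrite (is_lim_seq_unique _ _ H). Qed.

Lemma iter_one_pos (n : nat) : 0 < Nat.iter n (Lop m s) (fun _ => 1) 0.
Proof. apply iter_Lop_pos. lra. Qed.

Lemma nu_one : nu (fun _ => 1) = 1.
Proof.
  apply nu_eq. apply (is_lim_seq_ext (fun _ => 1)); [|apply is_lim_seq_const].
  intros n. unfold ratio. field. apply Rgt_not_eq, iter_one_pos.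
Qed.

Lemma nu_linear (a b : R) (f g : R -> R) :
  c1_bounded f -> c1_bounded g -> nu (fun y => a * f y + b * g y) = a * nu f + b * nu g.
Proof.
  intros Hf Hg. apply nu_eq.
  apply (is_lim_seq_ext (fun n => a * ratio f n + b * ratio g n)).
  - intros n. unfold ratio. rewrite iter_Lop_linear. field. apply Rgt_not_eq, iter_one_pos.
  - apply is_lim_seq_plus'; apply is_lim_seq_mult'; try apply is_lim_seq_const; now apply nu_lim.
Qed.

Lemma nu_le_all (f g : R -> R) :
  c1_bounded f -> c1_bounded g -> (forall y, 0 <= y <= 1 -> f y <= g y) -> nu f <= nu g.
Proof.
  intros Hf Hg H.
  apply (is_lim_seq_le (ratio f) (ratio g) (nu f) (nu g)); [|now apply nu_lim|now apply nu_lim].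
  intros n. unfold ratio. apply Rmult_le_compat_r; [left; apply Rinv_0_lt_compat, iter_one_pos|].
  apply iter_Lop_le; [easy|lra].
Qed.

Lemma c1_bounded_const (c : R) : c1_bounded (fun _ => c).
Proof.
  exists (Rabs c), (fun _ => 0). intros x Hx. split; [apply @is_derive_const|].
  split; [lra|]. rewrite Rabs_R0. apply Rabs_pos.
Qed.

Lemma c1_bounded_plus (f g : R -> R) :
  c1_bounded f -> c1_bounded g -> c1_bounded (fun x => f x + g x).
Proof.
  intros (C & f' & Hf) (D & g' & Hg). exists (C + D), (fun x => f' x + g' x). intros x Hx.
  destruct (Hf x Hx) as (F1 & F2 & F3), (Hg x Hx) as (G1 & G2 & G3).
  split; [now apply (is_derive_plus f g)|].
  split; (eapply Rle_trans; [apply Rabs_triang|lra]).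
Qed.

Lemma c1_bounded_mult (f g : R -> R) :
  c1_bounded f -> c1_bounded g -> c1_bounded (fun x => f x * g x).
Proof.
  intros (C & f' & Hf) (D & g' & Hg). exists (2 * C * D + C * D), (fun x => f' x * g x + f x * g' x).
  intros x Hx. destruct (Hf x Hx) as (F1 & F2 & F3), (Hg x Hx) as (G1 & G2 & G3).
  pose proof (Rabs_pos (f x)). pose proof (Rabs_pos (g x)).
  pose proof (Rabs_pos (f' x)). pose proof (Rabs_pos (g' x)).
  assert (0 <= C * D) by (apply Rmult_le_pos; lra).
  split; [apply (is_derive_mult f g); [easy|easy|intros; apply Rmult_comm]|].
  split.
  - rewrite Rabs_mult. assert (Rabs (f x) * Rabs (g x) <= C * D) by (apply Rmult_le_compat; lra).
    lra.
  - eapply Rle_trans; [apply Rabs_triang|]. rewrite !Rabs_mult.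
    assert (Rabs (f' x) * Rabs (g x) <= C * D) by (apply Rmult_le_compat; lra).
    assert (Rabs (f x) * Rabs (g' x) <= C * D) by (apply Rmult_le_compat; lra). lra.
Qed.

Lemma c1_bounded_scal (c : R) (f : R -> R) : c1_bounded f -> c1_bounded (fun x => c * f x).
Proof. intros H. apply (c1_bounded_mult (fun _ => c)); [apply c1_bounded_const|easy]. Qed.

Lemma c1_bounded_ext (f g : R -> R) : (forall x, f x = g x) -> c1_bounded f -> c1_bounded g.
Proof.
  intros E (C & f' & H). exists C, f'. intros x Hx. destruct (H x Hx) as (H1 & H2).
  rewrite <- (E x). split; [|easy]. now apply (is_derive_ext f g x (f' x) E).
Qed.

Lemma c1_bounded_lsum {A : Type} (l : list A) (F : A -> R -> R) :
  (forall a, In a l -> c1_bounded (F a)) -> c1_bounded (fun x => lsum l (fun a => F a x)).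
Proof.
  induction l as [|a l IH]; intros H; simpl; [apply c1_bounded_const|].
  apply c1_bounded_plus; [apply H; now left|apply IH; intros; apply H; now right].
Qed.

Lemma nu_ext (f g : R -> R) : (forall y, 0 <= y <= 1 -> f y = g y) -> nu f = nu g.
Proof.
  intros H. unfold nu, ratio. f_equal. apply Lim_seq_ext. intros n. f_equal.
  apply Rle_antisym; (apply iter_Lop_le; [intros y Hy; rewrite (H y Hy); lra|lra]).
Qed.

Lemma nu_lsum {A : Type} (l : list A) (F : A -> R -> R) (c : A -> R) :
  (forall a, In a l -> c1_bounded (F a)) ->
  nu (fun y => lsum l (fun a => c a * F a y)) = lsum l (fun a => c a * nu (F a)).
Proof.
  induction l as [|a l IH]; intros H.
  - rewrite (nu_ext _ (fun _ => 0 * 1 + 0 * 1)) by (intros; simpl; ring).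
    rewrite (nu_linear 0 0 (fun _ => 1) (fun _ => 1)) by apply c1_bounded_const. simpl. ring.
  - simpl. rewrite <- IH by (intros; apply H; now right).
    rewrite <- (Rmult_1_l (nu (fun y => lsum l _))).
    rewrite <- nu_linear; [|apply H; now left|].
    + apply nu_ext. intros; ring.
    + apply c1_bounded_lsum. intros b Hb. apply c1_bounded_scal, H. now right.
Qed.

Lemma cone_c1_bounded (B : R) (f : R -> R) : 0 < B -> cone B f -> c1_bounded f.
Proof.
  intros HB Hf. pose proof (fun x Hx => cone_harnack B x 0 f HB Hf Hx) as Hk.
  assert (Z : 0 <= 0 <= 1) by lra. pose proof (cone_nonneg B f 0 Hf Z) as F0.
  destruct Hf as [f' H]. set (K := Rpower 2 B * f 0) in *.
  assert (0 <= K) by (apply Rmult_le_pos; [left; apply Rpower_pos|easy]).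
  exists (K + B * K), f'. intros x Hx.
  destruct (H x Hx) as (H1 & H2 & H3). specialize (Hk x Hx Z). change (f x <= K) in Hk.
  assert (0 <= B * K) by (apply Rmult_le_pos; lra).
  split; [easy|split]; [rewrite Rabs_pos_eq; lra|].
  assert (B / (1 + x) * f x <= B * K); [|lra].
  apply Rmult_le_compat; [|easy| |easy].
  - left; apply Rdiv_lt_0_compat; lra.
  - apply Rle_div_l; nra.
Qed.

Lemma c1_bounded_Lop (f : R -> R) : c1_bounded f -> c1_bounded (Lop m s f).
Proof.
  intros Hf. destruct (c1_bounded_cone f Hf) as (C & H1 & _).
  apply (c1_bounded_ext (fun x => Lop m s (fun x => f x - (- C) * 1) x
                                   + (- C) * Lop m s (fun _ => 1) x)).
  - intros x. rewrite <- (Rmult_1_l (Lop m s (fun x => _ - _) x)), <- Lop_linear.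
    unfold Lop. apply (lsum_ext m (fun j => _ * _) (fun j => _ * _)). intros; f_equal; ring.
  - apply c1_bounded_plus; [|apply c1_bounded_scal].
    + apply (cone_c1_bounded (2 * s + 8 * s / 2)); [lra|]. apply cone_Lop; [easy|lra|easy].
    + apply (cone_c1_bounded (8 * s)); [lra|]. apply (cone_iter_one 1).
Qed.

Definition lambda : R := nu (Lop m s (fun _ => 1)).

(** The n-th ratio for L f is the n-th ratio for L 1 times the (n+1)-st ratio for f: the iterates of
    1 telescope. *)
Lemma nu_Lop (f : R -> R) : c1_bounded f -> nu (Lop m s f) = lambda * nu f.
Proof.
  intros Hf. apply nu_eq.
  apply (is_lim_seq_ext (fun n => ratio (Lop m s (fun _ => 1)) n * ratio f (S n))).
  - intros n. unfold ratio. rewrite <- !Nat.iter_succ_r. field.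
    split; apply Rgt_not_eq, iter_one_pos.
  - apply is_lim_seq_mult'; [apply nu_lim, c1_bounded_Lop, c1_bounded_const|].
    apply (is_lim_seq_incr_1 (ratio f)). now apply nu_lim.
Qed.

Lemma nu_const (c : R) : nu (fun _ => c) = c.
Proof.
  rewrite (nu_ext _ (fun _ => c * 1 + 0 * 1)) by (intros; ring).
  rewrite (nu_linear c 0 (fun _ => 1) (fun _ => 1)), nu_one by apply c1_bounded_const. ring.
Qed.

Lemma lambda_pos : 0 < lambda.
Proof.
  destruct letter_bounded as (M & HM & H).
  apply Rlt_le_trans with (Rpower (1 + M) (- (2 * s))); [apply Rpower_pos|].
  rewrite <- (nu_const (Rpower _ _)). apply nu_le_all.
  - apply c1_bounded_const.
  - apply c1_bounded_Lop, c1_bounded_const.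
  - intros y Hy. destruct m as [|j l] eqn:E; [easy|]. rewrite <- E in *.
    assert (Hj : In j m) by (rewrite E; now left).
    pose proof (letter_ge_1 j Hj). specialize (H j Hj).
    apply Rle_trans with (Rpower (y + INR j) (- (2 * s)) * 1).
    + rewrite Rmult_1_r. apply Rpower_base_anti; lra.
    + apply (lsum_ge_term m (fun j => Rpower (y + INR j) (- (2 * s)) * 1) j Hj).
      intros i Hi. rewrite Rmult_1_r. left; apply Rpower_pos.
Qed.

(** Since [nu f] is [nu (Lop m s f) / lambda], only the values of f on the images of the maps
    [theta j] count. Those points are at most 1/gamma, which yields the derivative bound, and at
    least 1 / (1 + M), which yields strict positivity. *)
Lemma nu_le (f g : R -> R) :
  c1_bounded f -> c1_bounded g ->
  (forall j y, In j m -> 0 <= y <= 1 -> f (theta j y) <= g (theta j y)) -> nu f <= nu g.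
Proof.
  intros Hf Hg H. apply (Rmult_le_reg_l lambda); [apply lambda_pos|].
  rewrite <- !nu_Lop by easy. apply nu_le_all; [now apply c1_bounded_Lop..|].
  intros y Hy. apply lsum_le. intros j Hj. apply Rmult_le_compat_l; [left; apply Rpower_pos|].
  now apply H.
Qed.

Lemma nu_abs_le (f : R -> R) (C : R) :
  c1_bounded f -> (forall y, 0 <= y <= 1 -> Rabs (f y) <= C) -> Rabs (nu f) <= C.
Proof.
  intros Hf H. apply Rabs_le_between.
  enough (nu (fun _ => - C) <= nu f <= nu (fun _ => C)) by now rewrite !nu_const in *.
  split; apply nu_le_all; try apply c1_bounded_const; try easy;
    intros y Hy; specialize (H y Hy); apply Rabs_le_between in H; lra.
Qed.

(** * The eigenfunction and its derivatives *)

Definition ker (k : nat) (x y : R) : R := y ^ k * Rpower (1 + x * y) (- (2 * s + INR k)).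

Definition eigf (k : nat) (x : R) : R := nu (ker k x).

(** The margin to the left of 0 is what [Derive_n] needs at the endpoint 0, and the bound 1/2 keeps
    all negative powers of the base bounded. *)
Lemma kernel_base (x y : R) : - / 2 < x -> 0 <= y <= 1 -> / 2 <= 1 + x * y.
Proof. intros Hx Hy. nra. Qed.

Lemma c1_bounded_pow (k : nat) : c1_bounded (fun y => y ^ k).
Proof.
  induction k as [|k IH]; simpl; [apply c1_bounded_const|].
  apply (c1_bounded_mult (fun y => y)); [|easy]. exists 1, (fun _ => 1). intros x Hx.
  split; [apply @is_derive_id|]. rewrite !Rabs_pos_eq; lra.
Qed.

Lemma c1_bounded_Rpower_affine (x a : R) :
  - / 2 < x -> 0 <= a -> c1_bounded (fun y => Rpower (1 + x * y) (- a)).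
Proof.
  intros Hx Ha.
  exists (Rpower (/ 2) (- a) + Rabs x * (a * Rpower (/ 2) (- a - 1))).
  exists (fun y => x * (- a * Rpower (1 + x * y) (- a - 1))). intros y Hy.
  pose proof (kernel_base x y Hx Hy) as Hb.
  split; [apply is_derive_Rpower_affine; lra|].
  assert (Rpower (1 + x * y) (- a) <= Rpower (/ 2) (- a)) by (apply Rpower_base_anti; lra).
  assert (Rpower (1 + x * y) (- a - 1) <= Rpower (/ 2) (- a - 1)).
  { replace (- a - 1) with (- (a + 1)) by ring. apply Rpower_base_anti; lra. }
  pose proof (Rpower_pos (/ 2) (- a)). pose proof (Rpower_pos (/ 2) (- a - 1)).
  assert (0 <= Rabs x * (a * Rpower (/ 2) (- a - 1))).
  { apply Rmult_le_pos; [apply Rabs_pos|apply Rmult_le_pos; lra]. }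
  split.
  - rewrite Rabs_pos_eq by (left; apply Rpower_pos). lra.
  - rewrite !Rabs_mult, Rabs_Ropp, (Rabs_pos_eq a), (Rabs_pos_eq (Rpower _ _)) by
      (easy || left; apply Rpower_pos).
    assert (Rabs x * (a * Rpower (1 + x * y) (- a - 1)) <= Rabs x * (a * Rpower (/ 2) (- a - 1))).
    { apply Rmult_le_compat_l; [apply Rabs_pos|]. now apply Rmult_le_compat_l. }
    lra.
Qed.

Lemma c1_bounded_ker (k : nat) (x : R) : - / 2 < x -> c1_bounded (ker k x).
Proof.
  intros Hx. apply c1_bounded_mult; [apply c1_bounded_pow|].
  apply c1_bounded_Rpower_affine; [easy|]. pose proof (pos_INR k). lra.
Qed.

(** Two applications of the mean value theorem. The constant does not depend on y, so the estimate
    passes through [nu] by [nu_abs_le]. *)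
Lemma Rpower_affine_taylor (a x z y : R) :
  0 <= a -> - / 2 < x -> - / 2 < z -> 0 <= y <= 1 ->
  Rabs (Rpower (1 + z * y) (- a) - Rpower (1 + x * y) (- a)
        + (z - x) * (a * y * Rpower (1 + x * y) (- (a + 1))))
  <= a * (a + 1) * Rpower (/ 2) (- (a + 2)) * (z - x) ^ 2.
Proof.
  intros Ha Hx Hz Hy.
  assert (D : forall b t, - / 2 < t ->
    is_derive (fun t => Rpower (1 + t * y) (- b)) t (- b * y * Rpower (1 + t * y) (- (b + 1)))).
  { intros b t Ht. pose proof (kernel_base t y Ht Hy). evar_last.
    - apply (is_derive_ext (fun t => Rpower (1 + y * t) (- b)));
        [intros; now rewrite (Rmult_comm y)|]. apply is_derive_Rpower_affine. lra.
    - rewrite (Rmult_comm y t). replace (- b - 1) with (- (b + 1)) by ring. ring. }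
  assert (mm : forall u, - / 2 < u -> forall w, Rmin x u <= w <= Rmax x u -> - / 2 < w).
  { intros u Hu w. unfold Rmin. destruct (Rle_dec x u); lra. }
  destruct (mvt_bound _ _ x z (fun t Ht => D a t (mm z Hz t Ht))) as (c & Hc & E1).
  pose proof (mm z Hz c Hc) as Hc2.
  destruct (mvt_bound _ _ x c (fun t Ht => D (a + 1) t (mm c Hc2 t Ht))) as (d & Hd & E2).
  pose proof (mm c Hc2 d Hd) as Hd2. cbv beta in E1, E2. rewrite E1.
  replace (_ + _) with ((z - x) * (- a * y * (Rpower (1 + c * y) (- (a + 1))
                               - Rpower (1 + x * y) (- (a + 1))))) by ring.
  rewrite E2.
  replace ((z - x) * _) with (a * (a + 1) * (y * y) * Rpower (1 + d * y) (- (a + 1 + 1))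
                                * ((z - x) * (c - x))) by ring.
  replace (a + 1 + 1) with (a + 2) by ring.
  assert (B1 : Rpower (1 + d * y) (- (a + 2)) <= Rpower (/ 2) (- (a + 2))).
  { pose proof (kernel_base d y Hd2 Hy). apply Rpower_base_anti; lra. }
  assert (B2 : Rabs ((z - x) * (c - x)) <= (z - x) ^ 2).
  { rewrite Rabs_mult, <- pow2_abs. simpl. rewrite Rmult_1_r.
    apply Rmult_le_compat_l; [apply Rabs_pos|].
    unfold Rabs, Rmin, Rmax in *. destruct (Rle_dec x z), (Rcase_abs (c - x)), (Rcase_abs (z - x)); lra. }
  pose proof (Rpower_pos (1 + d * y) (- (a + 2))). assert (0 <= a * (a + 1)) by nra.
  rewrite Rabs_mult, (Rabs_pos_eq (_ * _ * _ * _)) by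
    (apply Rmult_le_pos; [apply Rmult_le_pos; nra|lra]).
  apply Rmult_le_compat; [apply Rmult_le_pos; [apply Rmult_le_pos; nra|lra]|apply Rabs_pos| |easy].
  apply Rmult_le_compat; [apply Rmult_le_pos; nra|lra| |easy].
  rewrite <- (Rmult_1_r (a * (a + 1))) at 2. apply Rmult_le_compat_l; nra.
Qed.

Lemma is_derive_quadratic (F : R -> R) (x l C d : R) :
  0 < d -> (forall z, Rabs (z - x) < d -> Rabs (F z - F x - (z - x) * l) <= C * (z - x) ^ 2) ->
  is_derive F x l.
Proof.
  clear. intros Hd H. apply is_derive_Reals. intros eps Heps.
  assert (HC : 0 <= Rabs C) by apply Rabs_pos.
  assert (P : 0 < Rmin d (eps / (Rabs C + 1))).
  { apply Rmin_pos; [easy|]. apply Rdiv_lt_0_compat; lra. }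
  exists (mkposreal _ P). intros h Hh0 Hh. simpl in Hh.
  assert (Hh1 : Rabs (x + h - x) < d).
  { replace (x + h - x) with h by ring. eapply Rlt_le_trans; [apply Hh|apply Rmin_l]. }
  assert (Hh2 : Rabs h < eps / (Rabs C + 1)) by (eapply Rlt_le_trans; [apply Hh|apply Rmin_r]).
  specialize (H _ Hh1). replace (x + h - x) with h in H by ring.
  replace ((F (x + h) - F x) / h - l) with ((F (x + h) - F x - h * l) / h) by (field; easy).
  unfold Rdiv. rewrite Rabs_mult, Rabs_inv. pose proof (Rabs_pos_lt h Hh0) as Hp.
  apply Rle_lt_trans with (Rabs C * Rabs h).
  - apply (Rmult_le_reg_r (Rabs h)); [easy|]. rewrite Rmult_assoc, Rinv_l, Rmult_1_r by lra.
    eapply Rle_trans; [apply H|]. rewrite <- pow2_abs.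
    replace (Rabs C * Rabs h * Rabs h) with (Rabs C * Rabs h ^ 2) by ring.
    apply Rmult_le_compat_r; [apply pow2_ge_0|apply Rle_abs].
  - apply Rlt_div_r in Hh2; [|lra]. nra.
Qed.

Lemma is_derive_eigf (k : nat) (x : R) :
  - / 2 < x -> is_derive (eigf k) x (- (2 * s + INR k) * eigf (S k) x).
Proof.
  intros Hx. set (a := 2 * s + INR k). assert (Ha : 0 <= a).
  { unfold a. pose proof (pos_INR k). lra. }
  (* The radius x + 1/2 keeps z in the domain z > -1/2. *)
  apply (is_derive_quadratic _ _ _ (a * (a + 1) * Rpower (/ 2) (- (a + 2))) (x + / 2)); [lra|].
  intros z Hz. apply Rabs_lt_between in Hz. assert (Hz1 : - / 2 < z) by lra.
  pose proof (c1_bounded_ker k x Hx) as C1. pose proof (c1_bounded_ker k z Hz1) as C2.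
  pose proof (c1_bounded_ker (S k) x Hx) as C3.
  assert (C4 : c1_bounded (fun y => 1 * ker k z y + (-1) * ker k x y)).
  { apply c1_bounded_plus; now apply c1_bounded_scal. }
  (* Linearity collects the whole remainder into [nu] of a single function, which is then estimated
     pointwise. *)
  replace (eigf k z - eigf k x - (z - x) * (- a * eigf (S k) x))
    with (nu (fun y => 1 * (1 * ker k z y + (-1) * ker k x y) + ((z - x) * a) * ker (S k) x y)).
  2: { rewrite (nu_linear 1 ((z - x) * a) (fun y => 1 * ker k z y + (-1) * ker k x y)) by easy.
       rewrite nu_linear by easy. unfold eigf. ring. }
  apply nu_abs_le.
  { apply c1_bounded_plus; now apply c1_bounded_scal. }
  intros y Hy. unfold ker.
  replace (2 * s + INR (S k)) with (a + 1) by (rewrite S_INR; unfold a; ring). fold a.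
  replace (_ + _) with (y ^ k * (Rpower (1 + z * y) (- a) - Rpower (1 + x * y) (- a)
        + (z - x) * (a * y * Rpower (1 + x * y) (- (a + 1))))) by (simpl; ring).
  rewrite Rabs_mult, (Rabs_pos_eq (y ^ k)) by now apply pow_le.
  assert (y ^ k <= 1) by (rewrite <- (pow1 k); now apply pow_incr).
  assert (0 <= y ^ k) by now apply pow_le.
  pose proof (Rpower_affine_taylor a x z y Ha Hx Hz1 Hy) as T.
  eapply Rle_trans; [|apply T]. pose proof (Rabs_pos (Rpower (1 + z * y) (- a) - Rpower (1 + x * y) (- a)
        + (z - x) * (a * y * Rpower (1 + x * y) (- (a + 1))))). nra.
Qed.

Lemma Derive_n_eigf (k : nat) (x : R) :
  - / 2 < x -> Derive_n (eigf 0) k x = (-1) ^ k * rising (2 * s) k * eigf k x.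
Proof.
  revert x. induction k as [|k IH]; intros x Hx; simpl; [ring|].
  rewrite (Derive_ext_loc _ (fun t => (-1) ^ k * rising (2 * s) k * eigf k t)).
  - rewrite Derive_scal, (is_derive_unique _ _ _ (is_derive_eigf k x Hx)). ring.
  - apply (filter_imp (fun t => - / 2 < t)); [exact IH|]. now apply open_gt.
Qed.

Lemma ex_derive_n_eigf (k : nat) (x : R) : - / 2 < x -> ex_derive_n (eigf 0) k x.
Proof.
  intros Hx. destruct k as [|k]; simpl; [easy|].
  apply (ex_derive_ext_loc (fun t => (-1) ^ k * rising (2 * s) k * eigf k t)).
  - apply (filter_imp (fun t => - / 2 < t)); [|now apply open_gt].
    intros t Ht. symmetry. now apply Derive_n_eigf.
  - apply ex_derive_scal. eexists. now apply is_derive_eigf.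
Qed.

Lemma Rpower_mult_distr_inv (u w c : R) : 0 < u -> 0 <= w ->
  Rpower u c * Rpower (1 + / u * w) c = Rpower (u + w) c.
Proof.
  clear. intros Hu Hw. rewrite Rpower_mult_distr; [f_equal; field; lra|easy|].
  assert (0 <= / u * w) by (apply Rmult_le_pos; [left; now apply Rinv_0_lt_compat|easy]). lra.
Qed.

(* Both sides are [sum (x + j + y)^(-2s)]: the kernel is symmetric under the transfer operator. *)
Lemma Lop_ker_sym (x y : R) : 0 <= x <= 1 -> 0 <= y <= 1 ->
  lsum m (fun j => Rpower (x + INR j) (- (2 * s)) * ker 0 (theta j x) y) = Lop m s (ker 0 x) y.
Proof.
  intros Hx Hy. apply lsum_ext. intros j Hj. pose proof (letter_ge_1 j Hj).
  unfold ker, theta. simpl. rewrite Rplus_0_r, !Rmult_1_l.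
  rewrite (Rmult_comm x), !Rpower_mult_distr_inv by lra. f_equal. ring.
Qed.

Lemma eigf_eigen (x : R) : 0 <= x <= 1 -> Lop m s (eigf 0) x = lambda * eigf 0 x.
Proof.
  intros Hx. unfold eigf at 2. rewrite <- nu_Lop by (apply c1_bounded_ker; lra).
  rewrite (nu_ext _ _ (fun y Hy => eq_sym (Lop_ker_sym x y Hx Hy))).
  rewrite (nu_lsum m (fun j => ker 0 (theta j x))); [easy|].
  intros j Hj. apply c1_bounded_ker.
  pose proof (theta_bounds j x (letter_ge_1 j Hj) Hx). lra.
Qed.

Lemma eigf_at_0 : eigf 0 0 = 1.
Proof.
  unfold eigf. rewrite <- nu_one. apply nu_ext. intros y _. unfold ker, Rpower.
  replace (1 + 0 * y) with 1 by ring. rewrite ln_1, Rmult_0_r, exp_0. apply Rmult_1_r.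
Qed.

Lemma eigf_bounds (x : R) : 0 <= x <= 1 -> Rpower 2 (- (2 * s)) <= eigf 0 x <= 1.
Proof.
  intros Hx. assert (Hx1 : - / 2 < x) by lra.
  enough (nu (fun _ => Rpower 2 (- (2 * s))) <= eigf 0 x <= nu (fun _ => 1))
    by now rewrite !nu_const in *.
  split; (apply nu_le_all; [try apply c1_bounded_const; now apply c1_bounded_ker
                           |try apply c1_bounded_const; now apply c1_bounded_ker|]);
    intros y Hy; unfold ker; simpl; rewrite Rplus_0_r, Rmult_1_l;
    assert (0 <= x * y <= 1) by nra.
  - apply Rpower_base_anti; lra.
  - apply Rpower_le_1; lra.
Qed.

(** For k > 0 the kernel vanishes at y = 0, so a pointwise bound on [0,1] is not enough; [nu_le]
    restricts y to y >= 1 / (1 + M). *)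
Lemma eigf_pos (k : nat) (x : R) : 0 <= x <= 1 -> 0 < eigf k x.
Proof.
  intros Hx. assert (Hx1 : - / 2 < x) by lra. destruct letter_bounded as (M & HM & H).
  apply Rlt_le_trans with (nu (fun _ => (/ (1 + M)) ^ k * Rpower 2 (- (2 * s + INR k)))).
  - rewrite nu_const. apply Rmult_lt_0_compat; [apply pow_lt, Rinv_0_lt_compat; lra|apply Rpower_pos].
  - apply nu_le; [apply c1_bounded_const|now apply c1_bounded_ker|]. intros j y Hj Hy.
    pose proof (letter_ge_1 j Hj) as H1. pose proof (theta_bounds j y H1 Hy). specialize (H j Hj).
    assert (0 < / (1 + M)) by (apply Rinv_0_lt_compat; lra). pose proof (pos_INR k).
    apply Rmult_le_compat.
    + apply pow_le. lra.
    + left; apply Rpower_pos.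
    + apply pow_incr. split; [lra|]. apply Rinv_le_contravar; lra.
    + apply Rpower_base_anti; nra.
Qed.

Lemma eigf_le_min_letter (g : R) (k : nat) (x : R) :
  0 < g -> (forall j, In j m -> g <= INR j) -> 0 <= x <= 1 -> eigf k x <= / g ^ k * eigf 0 x.
Proof.
  intros Hg H Hx. assert (Hx1 : - / 2 < x) by lra. unfold eigf at 2.
  pose proof (c1_bounded_ker 0 x Hx1) as C0.
  replace (/ g ^ k * nu (ker 0 x)) with (nu (fun y => / g ^ k * ker 0 x y + 0 * ker 0 x y))
    by (rewrite nu_linear by easy; ring).
  apply nu_le; [now apply c1_bounded_ker|apply c1_bounded_plus; now apply c1_bounded_scal|].
  intros j y Hj Hy. pose proof (letter_ge_1 j Hj) as H1. pose proof (theta_bounds j y H1 Hy).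
  rewrite Rmult_0_l, Rplus_0_r, <- pow_inv. unfold ker. simpl. rewrite Rplus_0_r, Rmult_1_l.
  pose proof (pos_INR k). assert (1 <= 1 + x * theta j y) by nra. apply Rmult_le_compat.
  - now apply pow_le.
  - left; apply Rpower_pos.
  - apply pow_incr. split; [easy|]. apply Rinv_le_contravar; [easy|]. specialize (H j Hj). lra.
  - apply Rle_Rpower; lra.
Qed.

Lemma iter_Lop_eigf (n : nat) (x : R) :
  0 <= x <= 1 -> Nat.iter n (Lop m s) (eigf 0) x = lambda ^ n * eigf 0 x.
Proof.
  revert x. induction n as [|n IH]; intros x Hx; simpl; [ring|].
  rewrite (Lop_ext s _ (fun y => lambda ^ n * eigf 0 y + 0 * eigf 0 y)); [|intros; rewrite IH; [ring|easy]|easy].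
  rewrite Lop_linear, eigf_eigen by easy. ring.
Qed.

Lemma iter_one_ge (n : nat) : lambda ^ n <= Nat.iter n (Lop m s) (fun _ => 1) 0.
Proof.
  replace (lambda ^ n) with (Nat.iter n (Lop m s) (eigf 0) 0)
    by (rewrite iter_Lop_eigf, eigf_at_0 by lra; ring).
  apply iter_Lop_le; [|lra]. intros x Hx. now apply eigf_bounds.
Qed.

Lemma iter_one_le (n : nat) (x : R) : 0 <= x <= 1 ->
  Nat.iter n (Lop m s) (fun _ => 1) x <= Rpower 2 (2 * s) * lambda ^ n.
Proof.
  intros Hx. pose proof (Rpower_pos 2 (2 * s)) as P.
  apply Rle_trans with (Nat.iter n (Lop m s)
     (fun y => Rpower 2 (2 * s) * eigf 0 y + 0 * eigf 0 y) x).
  - apply iter_Lop_le; [|easy]. intros y Hy. destruct (eigf_bounds y Hy) as [B _].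
    rewrite Rpower_Ropp in B.
    assert (Rpower 2 (2 * s) * / Rpower 2 (2 * s) <= Rpower 2 (2 * s) * eigf 0 y)
      by (apply Rmult_le_compat_l; lra).
    rewrite Rinv_r in * by lra. lra.
  - rewrite iter_Lop_linear, iter_Lop_eigf by easy. destruct (eigf_bounds x Hx) as [_ B].
    pose proof (pow_lt lambda n lambda_pos).
    assert (Rpower 2 (2 * s) * lambda ^ n * eigf 0 x <= Rpower 2 (2 * s) * lambda ^ n * 1)
      by (apply Rmult_le_compat_l; nra). lra.
Qed.

Lemma Rpower_root (x : R) (n : nat) : 0 < x -> Rpower (x ^ S n) (/ INR (S n)) = x.
Proof.
  clear. intros Hx. rewrite <- Rpower_pow, Rpower_mult, Rinv_r, Rpower_1; [easy|easy| |easy].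
  now apply not_0_INR.
Qed.

(** A positive operator on [0,1] is largest on the constant 1, and 1 lies between the eigenfunction
    and 2^(2s) times it. The factor 2^(2s) does not depend on n and disappears in the n-th root. The
    two bounds also show that the supremum is finite, so [real] loses nothing. *)
Lemma opnorm_iter_bounds (n : nat) :
  lambda ^ n <= real (opnorm (Nat.iter n (Lop m s))) <= Rpower 2 (2 * s) * lambda ^ n.
Proof.
  unfold opnorm, Rbar_lub. destruct Rbar_ex_lub as [r [Hub Hl]]. simpl.
  assert (H1 : Rbar_le r (Rpower 2 (2 * s) * lambda ^ n)).
  { apply Hl. intros t (w & x & Hw & Hw1 & Hx & ->). simpl.
    eapply Rle_trans; [|now apply (iter_one_le n x)].
    apply Rabs_le_between. split.
    - replace (- Nat.iter n (Lop m s) (fun _ => 1) x)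
        with (Nat.iter n (Lop m s) (fun y => (-1) * 1 + 0 * 1) x)
        by (rewrite iter_Lop_linear; ring).
      apply iter_Lop_le; [|easy]. intros y Hy. specialize (Hw1 y Hy).
      apply Rabs_le_between in Hw1. lra.
    - apply iter_Lop_le; [|easy]. intros y Hy. specialize (Hw1 y Hy).
      apply Rabs_le_between in Hw1. lra. }
  assert (H2 : Rbar_le (lambda ^ n) r).
  { eapply Rbar_le_trans; [|apply Hub; exists (fun _ => 1), 0].
    - instantiate (1 := Rabs (Nat.iter n (Lop m s) (fun _ => 1) 0)).
      simpl. eapply Rle_trans; [apply iter_one_ge|apply Rle_abs].
    - split; [intros x Hx; apply filterlim_const|]. split; [intros; rewrite Rabs_R1; lra|].
      split; [lra|easy]. }
  destruct r; simpl in *; easy.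
Qed.

Lemma is_spectral_radius_lambda : is_spectral_radius (Lop m s) lambda.
Proof.
  pose proof lambda_pos as HL. pose proof (Rpower_pos 2 (2 * s)) as HK.
  unfold is_spectral_radius.
  apply (is_lim_seq_le_le (fun _ => lambda) _
           (fun n => Rpower (Rpower 2 (2 * s)) (/ INR (S n)) * lambda)).
  - intros n. destruct (opnorm_iter_bounds (S n)) as [B1 B2].
    assert (P : 0 < / INR (S n)) by (apply Rinv_0_lt_compat, lt_0_INR; lia).
    pose proof (pow_lt lambda (S n) HL). split.
    + rewrite <- (Rpower_root lambda n HL) at 1. apply Rle_Rpower_l; lra.
    + rewrite <- (Rpower_root lambda n HL). rewrite Rpower_mult_distr by easy.
      apply Rle_Rpower_l; lra.
  - apply is_lim_seq_const.
  - replace (Finite lambda) with (Finite (1 * lambda)) by (f_equal; ring). apply is_lim_seq_mult'; [|apply is_lim_seq_const].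
    unfold Rpower at 1. rewrite <- exp_0.
    apply (is_lim_seq_continuous exp (fun n => / INR (S n) * ln (Rpower 2 (2 * s))) 0).
    { apply derivable_continuous_pt, derivable_pt_exp. }
    rewrite <- (Rmult_0_l (ln (Rpower 2 (2 * s)))).
    apply is_lim_seq_mult'; [|apply is_lim_seq_const].
    apply (is_lim_seq_incr_1 (fun n => / INR n)).
    apply (is_lim_seq_inv INR p_infty); [apply is_lim_seq_INR|easy].
Qed.

Lemma cont01_eigf : cont01 (eigf 0).
Proof.
  intros x Hx. eapply filterlim_filter_le_1; [apply filter_le_within|].
  apply (ex_derive_continuous (eigf 0) x). eexists. apply is_derive_eigf. lra.
Qed.

End Transfer.

(** * Contraction along continued fractions *)

(* The distance between [1 / (1 + x)] and [1 / (1 + y)]: unlike the usual one, it is contracted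
   uniformly even by [theta 1]. *)
Definition dist1 (x y : R) : R := Rabs (x - y) / ((1 + x) * (1 + y)).

(** In this distance the denominators 1 + x and 1 + y become x + j + 1 and y + j + 1. On [0,1] these
    are larger by a factor of at least 3/2 each. *)
Lemma theta_dist1 (j : nat) (x y : R) : 1 <= INR j -> 0 <= x <= 1 -> 0 <= y <= 1 ->
  dist1 (theta j x) (theta j y) <= 4 / 9 * dist1 x y.
Proof.
  intros Hj Hx Hy. unfold dist1.
  replace (theta j x - theta j y) with ((y - x) * / ((x + INR j) * (y + INR j)))
    by (unfold theta; field; lra).
  rewrite Rabs_mult, (Rabs_pos_eq (/ _)) by (left; apply Rinv_0_lt_compat; nra).
  rewrite (Rabs_minus_sym y x).
  replace (_ / _) with (Rabs (x - y) * / ((x + INR j + 1) * (y + INR j + 1))) by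
    (unfold theta; field; lra).
  replace (4 / 9 * _) with (Rabs (x - y) * / ((1 + x) * (3 / 2) * ((1 + y) * (3 / 2)))) by
    (field; lra).
  apply Rmult_le_compat_l; [apply Rabs_pos|]. apply Rinv_le_contravar; [nra|].
  apply Rmult_le_compat; lra.
Qed.

Lemma comp_theta_bounds (a : nat -> nat) (n : nat) (y : R) :
  (forall i, 1 <= INR (a i)) -> 0 <= y <= 1 -> 0 <= comp_theta a n y <= 1.
Proof.
  intros Ha Hy. revert a Ha. induction n as [|n IH]; intros a Ha; simpl; [easy|].
  apply theta_bounds; [easy|]. now apply IH.
Qed.

Lemma comp_theta_add (a : nat -> nat) (n k : nat) (y : R) :
  comp_theta a (n + k) y = comp_theta a n (comp_theta (fun i => a (n + i)%nat) k y).
Proof.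
  revert a. induction n as [|n IH]; intros a; simpl; [easy|]. now rewrite IH.
Qed.

(* A word lists its letters from the innermost map to the outermost one. *)
Definition Th (w : list nat) (y : R) : R := fold_left (fun z j => theta j z) w y.

Fixpoint prefix (a : nat -> nat) (n : nat) : list nat :=
  match n with O => nil | S n' => a n' :: prefix a n' end.

Lemma comp_theta_Th (a : nat -> nat) (n : nat) (y : R) : comp_theta a n y = Th (prefix a n) y.
Proof.
  revert y. induction n as [|n IH]; intros y; [easy|].
  rewrite <- Nat.add_1_r, comp_theta_add. rewrite Nat.add_1_r, IH. simpl.
  now rewrite Nat.add_0_r.
Qed.

Lemma length_prefix (a : nat -> nat) (n : nat) : length (prefix a n) = n.
Proof. induction n as [|n IH]; simpl; [easy|now rewrite IH]. Qed.

Lemma prefix_incl (P : nat -> Prop) (a : nat -> nat) (n : nat) :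
  (forall i, P (a i)) -> forall j, In j (prefix a n) -> P j.
Proof. intros Ha. induction n as [|n IH]; simpl; [easy|]. intros j [<-|Hj]; auto. Qed.

Lemma Th_bounds (w : list nat) (y : R) :
  (forall j, In j w -> 1 <= INR j) -> 0 <= y <= 1 -> 0 <= Th w y <= 1.
Proof.
  revert y. induction w as [|j w IH]; intros y Hw Hy; simpl; [easy|].
  apply IH; [intros; apply Hw; now right|]. apply theta_bounds; [apply Hw; now left|easy].
Qed.

(** The 4 is the largest value of (1 + x) (1 + y), which converts [dist1] back to the usual
    distance. *)
Lemma Th_contract (w : list nat) (x y : R) :
  (forall j, In j w -> 1 <= INR j) -> 0 <= x <= 1 -> 0 <= y <= 1 ->
  Rabs (Th w x - Th w y) <= 4 * (4 / 9) ^ length w.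
Proof.
  intros Hw Hx Hy.
  assert (H : dist1 (Th w x) (Th w y) <= (4 / 9) ^ length w).
  { apply Rle_trans with ((4 / 9) ^ length w * dist1 x y).
    - revert x y Hx Hy. induction w as [|j w IH]; intros x y Hx Hy; simpl; [lra|].
      assert (Hj : 1 <= INR j) by (apply Hw; now left).
      eapply Rle_trans; [apply IH; [intros; apply Hw; now right| |]; now apply theta_bounds|].
      rewrite (Rmult_comm (4 / 9)), Rmult_assoc.
      apply Rmult_le_compat_l; [apply pow_le; lra|]. now apply theta_dist1.
    - rewrite <- (Rmult_1_r ((4 / 9) ^ length w)) at 2.
      apply Rmult_le_compat_l; [apply pow_le; lra|].
      unfold dist1. apply Rle_div_l; [nra|]. apply Rabs_le_between. split; nra. }
  pose proof (Th_bounds w x Hw Hx). pose proof (Th_bounds w y Hw Hy).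
  unfold dist1 in H. apply Rle_div_l in H; [|nra].
  pose proof (pow_lt (4 / 9) (length w) ltac:(lra)).
  assert ((1 + Th w x) * (1 + Th w y) <= 2 * 2) by (apply Rmult_le_compat; lra). nra.
Qed.

Lemma comp_theta_contract (a : nat -> nat) (n : nat) (x y : R) :
  (forall i, 1 <= INR (a i)) -> 0 <= x <= 1 -> 0 <= y <= 1 ->
  Rabs (comp_theta a n x - comp_theta a n y) <= 4 * (4 / 9) ^ n.
Proof.
  intros Ha Hx Hy. rewrite !comp_theta_Th. replace n with (length (prefix a n)) at 3
    by apply length_prefix.
  apply Th_contract; [|easy|easy]. now apply (prefix_incl (fun j => 1 <= INR j)).
Qed.

Lemma geom_4_9 (c : R) : is_lim_seq (fun n => c * (4 / 9) ^ n) 0.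
Proof.
  rewrite <- (Rmult_0_r c). apply is_lim_seq_mult'; [apply is_lim_seq_const|].
  apply is_lim_seq_geom. rewrite Rabs_pos_eq; lra.
Qed.

Lemma comp_theta_lim (a : nat -> nat) :
  (forall i, 1 <= INR (a i)) ->
  exists p : R, 0 <= p <= 1 /\
    forall y, 0 <= y <= 1 -> is_lim_seq (fun n => comp_theta a n y) p.
Proof.
  intros Ha. assert (Z : 0 <= 0 <= 1) by lra.
  assert (E : ex_finite_lim_seq (fun n => comp_theta a n 0)).
  { apply ex_lim_seq_cauchy_corr. intros eps.
    pose proof (geom_4_9 4) as G. apply is_lim_seq_spec in G.
    destruct (G (pos_div_2 eps)) as [N HN]. specialize (HN N (Nat.le_refl N)).
    simpl in HN. rewrite Rminus_0_r, Rabs_pos_eq in HN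
      by (apply Rmult_le_pos; [lra|apply pow_le; lra]).
    assert (K : forall n, (N <= n)%nat ->
              Rabs (comp_theta a n 0 - comp_theta a N 0) <= 4 * (4 / 9) ^ N).
    { intros n Hn. replace n with (N + (n - N))%nat by lia. rewrite comp_theta_add.
      apply comp_theta_contract; [easy| |easy]. now apply comp_theta_bounds. }
    exists N. intros n p Hn Hp. pose proof (K n Hn) as Kn. pose proof (K p Hp) as Kp.
    apply Rabs_le_between in Kn. apply Rabs_le_between in Kp. apply Rabs_lt_between. lra. }
  destruct E as [p Hp]. exists p. split.
  - split.
    + apply (is_lim_seq_le (fun _ => 0) (fun n => comp_theta a n 0) 0 p); [|apply is_lim_seq_const|easy].
      intros n. now apply comp_theta_bounds.
    + apply (is_lim_seq_le (fun n => comp_theta a n 0) (fun _ => 1) p 1); [|easy|apply is_lim_seq_const].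
      intros n. now apply comp_theta_bounds.
  - intros y Hy.
    apply (is_lim_seq_ext (fun n => comp_theta a n 0 + (comp_theta a n y - comp_theta a n 0)));
      [intros; ring|].
    replace (Finite p) with (Finite (p + 0)) by (f_equal; ring). apply is_lim_seq_plus'; [easy|].
    apply is_lim_seq_abs_0.
    apply (is_lim_seq_le_le (fun _ => 0) _ (fun n => 4 * (4 / 9) ^ n));
      [|apply is_lim_seq_const|apply geom_4_9].
    intros n. split; [apply Rabs_pos|]. now apply comp_theta_contract.
Qed.

(** * Uniqueness of the positive eigenfunction *)

(** Composition with this retraction turns continuity within [0,1] into continuity on the whole
    line, as the extreme value theorem expects. *)
Definition clamp (x : R) : R := Rmax 0 (Rmin 1 x).

Lemma clamp_id (x : R) : 0 <= x <= 1 -> clamp x = x.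
Proof. intros H. unfold clamp. rewrite Rmin_right, Rmax_right; lra. Qed.

Lemma clamp_bounds (x : R) : 0 <= clamp x <= 1.
Proof. unfold clamp, Rmax, Rmin. destruct (Rle_dec 1 x), (Rle_dec 0 _); lra. Qed.

Lemma clamp_lip (x y : R) : Rabs (clamp y - clamp x) <= Rabs (y - x).
Proof.
  unfold clamp, Rmax, Rmin, Rabs.
  repeat (destruct (Rle_dec _ _) || destruct (Rcase_abs _)); lra.
Qed.

Lemma cont01_clamp (w : R -> R) (x : R) : cont01 w -> continuous (fun t => w (clamp t)) x.
Proof.
  intros H.
  apply (filterlim_comp _ _ _ clamp w (locally x)
           (within (fun t => 0 <= t <= 1) (locally (clamp x)))).
  - intros P [d Hd]. exists d. intros y Hy. apply Hd; [|apply clamp_bounds].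
    eapply Rle_lt_trans; [apply clamp_lip|exact Hy].
  - apply H, clamp_bounds.
Qed.

Lemma Lop_vanish (m : list nat) (s : R) (u : R -> R) (y : R) (j : nat) :
  (forall k, In k m -> (0 < k)%nat) -> In j m -> 0 <= y <= 1 ->
  (forall x, 0 <= x <= 1 -> 0 <= u x) -> Lop m s u y = 0 -> u (theta j y) = 0.
Proof.
  intros Hpos Hj Hy Hu H0.
  pose proof (theta_bounds j y (letter_ge_1 m Hpos j Hj) Hy) as Ht.
  assert (H : Rpower (y + INR j) (- (2 * s)) * u (theta j y) <= 0).
  { rewrite <- H0. apply (lsum_ge_term m (fun j => Rpower (y + INR j) (- (2 * s)) * u (theta j y)) j Hj).
    intros i Hi. apply Rmult_le_pos; [left; apply Rpower_pos|].
    apply Hu, theta_bounds; [now apply (letter_ge_1 m)|easy]. }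
  specialize (Hu _ Ht). pose proof (Rpower_pos (y + INR j) (- (2 * s))). nra.
Qed.

Lemma eigen_vanish_orbit (m : list nat) (s mu : R) (u : R -> R) (x : R) (j n : nat) :
  (forall k, In k m -> (0 < k)%nat) -> In j m -> 0 <= x <= 1 ->
  (forall y, 0 <= y <= 1 -> 0 <= u y) ->
  (forall y, 0 <= y <= 1 -> Lop m s u y = mu * u y) ->
  u x = 0 -> u (comp_theta (fun _ => j) n x) = 0.
Proof.
  intros Hpos Hj Hx Hu He H0. induction n as [|n IH]; [easy|].
  change (u (theta j (comp_theta (fun _ => j) n x)) = 0).
  assert (B : 0 <= comp_theta (fun _ => j) n x <= 1).
  { apply comp_theta_bounds; [|easy]. intros; now apply (letter_ge_1 m). }
  apply (Lop_vanish m s u _ j Hpos Hj B Hu). rewrite He by easy. rewrite IH. ring.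
Qed.

(** Let q = w / v have its minimum at x0 and its maximum at x1. Once the eigenvalues agree, w -
    q(x0) v is a nonnegative eigenfunction vanishing at x0, hence along the orbit of x0 under a
    single [theta j]. This orbit tends to a point p, so q(p) = q(x0). The orbit of x1 tends to the
    same p, so q(p) = q(x1), and q is constant. *)
Lemma positive_eigenfunction_unique (m : list nat) (s lam mu : R) (v w : R -> R) :
  (forall k, In k m -> (0 < k)%nat) -> m <> nil ->
  cont01 v -> (forall x, 0 <= x <= 1 -> 0 < v x) ->
  (forall x, 0 <= x <= 1 -> Lop m s v x = lam * v x) ->
  cont01 w -> (forall x, 0 <= x <= 1 -> 0 < w x) ->
  (forall x, 0 <= x <= 1 -> Lop m s w x = mu * w x) ->
  exists c, 0 < c /\ forall x, 0 <= x <= 1 -> w x = c * v x.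
Proof.
  intros Hpos Hne Cv Pv Ev Cw Pw Ew.
  set (q := fun t => w (clamp t) / v (clamp t)).
  assert (Cq : forall x, continuous q x).
  { intros x. apply (continuous_mult (fun t => w (clamp t)) (fun t => / v (clamp t))).
    - now apply cont01_clamp.
    - apply (filterlim_comp _ _ _ (fun t => v (clamp t)) Rinv (locally x)
               (locally (v (clamp x)))); [now apply cont01_clamp|].
      apply (filterlim_Rbar_inv (v (clamp x))). intros E. injection E as E.
      pose proof (Pv _ (clamp_bounds x)). lra. }
  assert (Eq : forall x, 0 <= x <= 1 -> w x = q x * v x).
  { intros x Hx. unfold q. rewrite clamp_id by easy. specialize (Pv x Hx). field. lra. }
  assert (Cq' : forall x, 0 <= x <= 1 -> continuity_pt q x).
  { intros x _. apply continuity_pt_filterlim, Cq. }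
  destruct (continuity_ab_min q 0 1 ltac:(lra) Cq') as (x0 & Hmin & Hx0).
  destruct (continuity_ab_maj q 0 1 ltac:(lra) Cq') as (x1 & Hmax & Hx1).
  assert (Lin : forall c d x, Lop m s (fun y => c * w y + d * v y) x
                            = c * Lop m s w x + d * Lop m s v x).
  { intros. apply Lop_linear. }
  assert (U0 : forall y, 0 <= y <= 1 -> 0 <= 1 * w y + - q x0 * v y).
  { intros y Hy. rewrite (Eq y Hy). specialize (Hmin y Hy). specialize (Pv y Hy). nra. }
  assert (U1 : forall y, 0 <= y <= 1 -> 0 <= (-1) * w y + q x1 * v y).
  { intros y Hy. rewrite (Eq y Hy). specialize (Hmax y Hy). specialize (Pv y Hy). nra. }
  (* Applying the operator to w - q(x0) v >= 0 and evaluating at x0 gives (mu - lam) w(x0) >= 0; the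
     maximum gives the opposite sign. *)
  assert (lam = mu).
  { apply Rle_antisym.
    - pose proof (Lop_nonneg m Hpos s _ U0 x0 Hx0) as N. rewrite Lin, Ew, Ev, (Eq x0) in N by easy.
      assert (0 < q x0 * v x0) by (rewrite <- Eq by easy; now apply Pw).
      apply (Rmult_le_reg_r (q x0 * v x0)); lra.
    - pose proof (Lop_nonneg m Hpos s _ U1 x1 Hx1) as N. rewrite Lin, Ew, Ev, (Eq x1) in N by easy.
      assert (0 < q x1 * v x1) by (rewrite <- Eq by easy; now apply Pw).
      apply (Rmult_le_reg_r (q x1 * v x1)); lra. }
  subst mu.
  destruct m as [|j l] eqn:Em; [easy|]. rewrite <- Em in *.
  assert (Hj : In j m) by (rewrite Em; now left).
  assert (Hj1 : forall i : nat, 1 <= INR j) by (intros; now apply (letter_ge_1 m)).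
  destruct (comp_theta_lim (fun _ => j) Hj1) as (p & Hp & Lp).
  (* The signs c = 1 and c = -1 serve the minimum and the maximum respectively. *)
  assert (Q : forall x c d, 0 <= x <= 1 -> c <> 0 ->
     (forall y, 0 <= y <= 1 -> 0 <= c * w y + d * v y) ->
     c * w x + d * v x = 0 -> c * q p + d = 0).
  { intros x c d Hx Hc Hu H0.
    assert (V : forall n, c * q (comp_theta (fun _ => j) n x) + d = 0).
    { intros n.
      assert (B : 0 <= comp_theta (fun _ => j) n x <= 1) by now apply comp_theta_bounds.
      assert (V : (fun y => c * w y + d * v y) (comp_theta (fun _ => j) n x) = 0).
      { apply (eigen_vanish_orbit m s lam _ x j n Hpos Hj Hx Hu); [|easy].
        intros y Hy. rewrite Lin, Ew, Ev by easy. ring. }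
      simpl in V. rewrite (Eq _ B) in V. specialize (Pv _ B).
      apply (Rmult_eq_reg_r (v (comp_theta (fun _ => j) n x))); lra. }
    assert (G : is_lim_seq (fun n => q (comp_theta (fun _ => j) n x)) (q p)).
    { apply is_lim_seq_continuous; [now apply Cq'|now apply Lp]. }
    assert (G2 : is_lim_seq (fun n => q (comp_theta (fun _ => j) n x)) (- d / c)).
    { apply (is_lim_seq_ext (fun _ => - d / c)); [|apply is_lim_seq_const].
      intros n. specialize (V n). apply (Rmult_eq_reg_l c); [|easy]. field_simplify; [lra|easy]. }
    apply is_lim_seq_unique in G. apply is_lim_seq_unique in G2. rewrite G in G2.
    injection G2 as ->. field. easy. }
  pose proof (Q x0 1 (- q x0) Hx0 ltac:(lra) U0 ltac:(rewrite (Eq x0 Hx0); ring)) as Q0.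
  pose proof (Q x1 (-1) (q x1) Hx1 ltac:(lra) U1 ltac:(rewrite (Eq x1 Hx1); ring)) as Q1.
  exists (q x0). split.
  - unfold q. apply Rdiv_lt_0_compat; [apply Pw|apply Pv]; apply clamp_bounds.
  - intros x Hx. rewrite (Eq x Hx). specialize (Hmin x Hx). specialize (Hmax x Hx).
    f_equal. lra.
Qed.

(** * Dependence of the spectral radius on the exponent *)

Lemma c1_bounded_eigf (m : list nat) (Hpos : forall k, In k m -> (0 < k)%nat) (Hne : m <> nil)
  (s : R) (Hs : 0 < s) : c1_bounded (eigf m s 0).
Proof.
  exists (1 + 2 * s), (fun x => - (2 * s + INR 0) * eigf m s 1 x). intros x Hx.
  pose proof (eigf_bounds m Hpos Hne s Hs x Hx) as B. pose proof (Rpower_pos 2 (- (2 * s))).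
  pose proof (eigf_pos m Hpos Hne s Hs 1 x Hx).
  assert (L : eigf m s 1 x <= / 1 ^ 1 * eigf m s 0 x).
  { apply eigf_le_min_letter; try easy; [lra|]. now apply letter_ge_1. }
  replace (/ 1 ^ 1) with 1 in L by field.
  split; [apply is_derive_eigf; try easy; lra|]. simpl. rewrite Rplus_0_r.
  split; [rewrite Rabs_pos_eq; lra|].
  rewrite Rabs_mult, Rabs_Ropp, (Rabs_pos_eq (2 * s)), Rabs_pos_eq by lra. nra.
Qed.

Section Exponent.

Context (m : list nat) (Hpos : forall k, In k m -> (0 < k)%nat) (Hne : m <> nil).

(* Two steps are needed: [(x + 1)^(-2t)] gains nothing over [(x + 1)^(-2s)] at [x = 0], but
   [(x + i) (theta i x + j) = 1 + j (x + i) >= 2]. *)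
Lemma Lop2_exponent (s t : R) (u : R -> R) (x : R) :
  s <= t -> (forall y, 0 <= y <= 1 -> 0 <= u y) -> 0 <= x <= 1 ->
  Lop m t (Lop m t u) x <= Rpower 2 (- (2 * (t - s))) * Lop m s (Lop m s u) x.
Proof.
  intros Hst Hu Hx.
  change (Lop m s (Lop m s u) x)
    with (lsum m (fun i => Rpower (x + INR i) (- (2 * s)) * Lop m s u (theta i x))).
  rewrite <- lsum_scal. apply lsum_le. intros i Hi.
  pose proof (letter_ge_1 m Hpos i Hi) as H1. pose proof (theta_bounds i x H1 Hx) as H2.
  change (Lop m t u (theta i x))
    with (lsum m (fun j => Rpower (theta i x + INR j) (- (2 * t)) * u (theta j (theta i x)))).
  change (Lop m s u (theta i x))
    with (lsum m (fun j => Rpower (theta i x + INR j) (- (2 * s)) * u (theta j (theta i x)))).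
  rewrite <- !lsum_scal. apply lsum_le. intros j Hj.
  pose proof (letter_ge_1 m Hpos j Hj) as H3.
  rewrite <- !Rmult_assoc. apply Rmult_le_compat_r; [now apply Hu, theta_bounds|].
  rewrite (Rmult_assoc (Rpower 2 _)), !Rpower_mult_distr by lra.
  replace ((x + INR i) * (theta i x + INR j)) with (1 + INR j * (x + INR i))
    by (unfold theta; field; lra).
  assert (P : 2 <= 1 + INR j * (x + INR i)) by nra.
  replace (- (2 * t)) with (- (2 * (t - s)) + - (2 * s)) by ring.
  rewrite Rpower_plus. apply Rmult_le_compat_r; [left; apply Rpower_pos|].
  apply Rpower_base_anti; lra.
Qed.

Lemma nu_eigf_pos (s t : R) : 0 < s -> 0 < t -> 0 < nu m t (eigf m s 0).
Proof.
  intros Hs Ht. apply Rlt_le_trans with (Rpower 2 (- (2 * s))); [apply Rpower_pos|].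
  rewrite <- (nu_const m Hpos Hne t Ht (Rpower 2 (- (2 * s)))).
  apply nu_le_all; try easy; [apply c1_bounded_const|now apply c1_bounded_eigf|].
  intros y Hy. now apply eigf_bounds.
Qed.

(** Applying [nu m t] to the two-step comparison for the eigenfunction of s gives the inequality
    between the squares, which accounts for the rate 2^(-(t - s)) rather than 2^(-2(t - s)). *)
Lemma lambda_decay (s t : R) :
  0 < s -> s <= t -> lambda m t <= Rpower 2 (- (t - s)) * lambda m s.
Proof.
  intros Hs Hst. assert (Ht : 0 < t) by lra.
  pose proof (c1_bounded_eigf m Hpos Hne s Hs) as Cv.
  assert (Vpos : forall y, 0 <= y <= 1 -> 0 < eigf m s 0 y) by now apply eigf_pos.
  pose proof (nu_eigf_pos s t Hs Ht) as Nv.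
  pose proof (lambda_pos m Hpos Hne t Ht) as Lt. pose proof (lambda_pos m Hpos Hne s Hs) as Ls.
  assert (E : lambda m t * (lambda m t * nu m t (eigf m s 0))
     <= Rpower 2 (- (2 * (t - s))) * (lambda m s * lambda m s) * nu m t (eigf m s 0)).
  { rewrite <- (nu_Lop m Hpos Hne t Ht (eigf m s 0)) by exact Cv.
    rewrite <- (nu_Lop m Hpos Hne t Ht (Lop m t (eigf m s 0))) by now apply c1_bounded_Lop.
    replace (_ * nu m t (eigf m s 0)) with (nu m t (fun y =>
      Rpower 2 (- (2 * (t - s))) * (lambda m s * lambda m s) * eigf m s 0 y + 0 * eigf m s 0 y))
      by (rewrite nu_linear by easy; ring).
    apply nu_le_all; try easy.
    - apply c1_bounded_Lop; [easy..|]. now apply c1_bounded_Lop.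
    - apply c1_bounded_plus; now apply c1_bounded_scal.
    - intros y Hy. eapply Rle_trans; [apply (Lop2_exponent s); try easy|].
      + intros z Hz. left. now apply Vpos.
      + pose proof (iter_Lop_eigf m Hpos Hne s Hs 2 y Hy) as E. simpl in E. rewrite E. lra. }
  pose proof (Rpower_pos 2 (- (t - s))) as Pk.
  replace (- (2 * (t - s))) with (- (t - s) + - (t - s)) in E by ring. rewrite Rpower_plus in E.
  assert (E2 : lambda m t * lambda m t
     <= (Rpower 2 (- (t - s)) * lambda m s) * (Rpower 2 (- (t - s)) * lambda m s)).
  { apply (Rmult_le_reg_r (nu m t (eigf m s 0))); [easy|]. lra. }
  apply Rsqr_incr_0; [exact E2|lra|nra].
Qed.

(** In this direction one step is enough: y + j <= 1 + M bounds the loss in each weight when s is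
    raised to t. *)
Lemma lambda_lower (M s t : R) :
  (forall j, In j m -> INR j <= M) -> 0 < s -> s <= t ->
  Rpower (1 + M) (- (2 * (t - s))) * lambda m s <= lambda m t.
Proof.
  intros HM Hs Hst. assert (Ht : 0 < t) by lra.
  pose proof (c1_bounded_eigf m Hpos Hne s Hs) as Cv.
  assert (Vpos : forall y, 0 <= y <= 1 -> 0 < eigf m s 0 y) by now apply eigf_pos.
  pose proof (nu_eigf_pos s t Hs Ht) as Nv.
  apply (Rmult_le_reg_r (nu m t (eigf m s 0))); [easy|].
  rewrite <- (nu_Lop m Hpos Hne t Ht) by exact Cv.
  replace (_ * nu m t (eigf m s 0)) with (nu m t (fun y =>
    Rpower (1 + M) (- (2 * (t - s))) * lambda m s * eigf m s 0 y + 0 * eigf m s 0 y))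
    by (rewrite nu_linear by easy; ring).
  apply nu_le_all; try easy.
  - apply c1_bounded_plus; now apply c1_bounded_scal.
  - now apply c1_bounded_Lop.
  - intros y Hy. rewrite Rmult_0_l, Rplus_0_r, Rmult_assoc, <- eigf_eigen by easy.
    change (Lop m s (eigf m s 0) y)
      with (lsum m (fun j => Rpower (y + INR j) (- (2 * s)) * eigf m s 0 (theta j y))).
    rewrite <- lsum_scal. apply lsum_le. intros j Hj.
    pose proof (letter_ge_1 m Hpos j Hj) as H1. specialize (HM j Hj).
    rewrite <- Rmult_assoc. apply Rmult_le_compat_r; [left; now apply Vpos, theta_bounds|].
    replace (- (2 * t)) with (- (2 * (t - s)) + - (2 * s)) by ring. rewrite Rpower_plus.
    apply Rmult_le_compat_r; [left; apply Rpower_pos|]. apply Rpower_base_anti; lra.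
Qed.

Lemma lambda_decreasing (s t : R) : 0 < s -> s < t -> lambda m t < lambda m s.
Proof.
  intros Hs Hst. pose proof (lambda_pos m Hpos Hne s Hs).
  apply Rle_lt_trans with (Rpower 2 (- (t - s)) * lambda m s); [apply lambda_decay; lra|].
  rewrite <- (Rmult_1_l (lambda m s)) at 2. apply Rmult_lt_compat_r; [easy|].
  apply Rlt_le_trans with (Rpower 2 0); [apply Rpower_lt; lra|rewrite Rpower_O; lra].
Qed.

(** On the logarithmic scale the multiplicative comparison becomes a Lipschitz bound whose constant
    does not depend on s and t, and continuity follows from it. *)
Lemma ln_lambda_lip (M s t : R) :
  (forall j, In j m -> INR j <= M) -> 0 < s -> s <= t ->
  0 <= ln (lambda m s) - ln (lambda m t) <= 2 * ln (1 + M) * (t - s).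
Proof.
  intros HM Hs Hst. assert (Ht : 0 < t) by lra.
  pose proof (lambda_pos m Hpos Hne s Hs). pose proof (lambda_pos m Hpos Hne t Ht). split.
  - destruct (Rle_lt_or_eq_dec s t Hst) as [L| ->]; [|lra].
    pose proof (ln_increasing _ _ (lambda_pos m Hpos Hne t Ht) (lambda_decreasing s t Hs L)). lra.
  - pose proof (lambda_lower M s t HM Hs Hst) as L.
    assert (ln (Rpower (1 + M) (- (2 * (t - s))) * lambda m s) <= ln (lambda m t)).
    { apply ln_le; [|easy]. apply Rmult_lt_0_compat; [apply Rpower_pos|easy]. }
    rewrite ln_mult in * by (easy || apply Rpower_pos). unfold Rpower in *. rewrite ln_exp in *.
    lra.
Qed.

Lemma lambda_continuous (s : R) : 0 < s -> continuous (lambda m) s.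
Proof.
  intros Hs. destruct letter_bounded with (m := m) as (M & HM1 & HM).
  assert (C : continuous (fun t => ln (lambda m t)) s).
  { apply filterlim_locally. intros eps.
    assert (PM : 0 < 2 * ln (1 + M)) by (pose proof (ln_increasing 1 (1 + M)); rewrite ln_1 in *; lra).
    assert (P : 0 < Rmin s (eps / (2 * ln (1 + M)))).
    { apply Rmin_pos; [easy|]. apply Rdiv_lt_0_compat; [apply cond_pos|easy]. }
    exists (mkposreal _ P). intros t Ht. change (Rabs (t - s) < Rmin s (eps / (2 * ln (1 + M)))) in Ht.
    change (Rabs (ln (lambda m t) - ln (lambda m s)) < eps).
    pose proof (Rmin_l s (eps / (2 * ln (1 + M)))). pose proof (Rmin_r s (eps / (2 * ln (1 + M)))).
    assert (H2 : Rabs (t - s) < eps / (2 * ln (1 + M))) by lra. apply Rlt_div_r in H2; [|easy].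
    assert (Ht0 : 0 < t) by (apply Rabs_lt_between in Ht; lra).
    destruct (Rle_or_lt s t) as [L|L].
    - pose proof (ln_lambda_lip M s t HM Hs L). rewrite (Rabs_pos_eq (t - s)) in H2 by lra.
      rewrite Rabs_minus_sym, Rabs_pos_eq; lra.
    - pose proof (ln_lambda_lip M t s HM Ht0 (Rlt_le _ _ L)).
      rewrite (Rabs_left (t - s)) in H2 by lra. rewrite Rabs_pos_eq; lra. }
  apply (continuous_ext_loc (lambda m) (fun t => exp (ln (lambda m t))) s).
  - apply (filter_imp (fun t => 0 < t)); [|now apply open_gt].
    intros t Ht. apply exp_ln. now apply lambda_pos.
  - apply (continuous_comp (fun t => ln (lambda m t)) exp); [easy|].
    apply continuity_pt_filterlim, derivable_continuous_pt, derivable_pt_exp.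
Qed.

Lemma lambda_crosses_one :
  (2 <= length m)%nat -> exists s0, 0 < s0 /\ lambda m s0 = 1.
Proof.
  intros Hlen. destruct letter_bounded with (m := m) as (M & HM1 & HM).
  assert (PM : 0 < ln (1 + M)) by (pose proof (ln_increasing 1 (1 + M)); rewrite ln_1 in *; lra).
  assert (P2 : 0 < ln 2) by (pose proof (ln_increasing 1 2); rewrite ln_1 in *; lra).
  (* Here (1 + M)^(-2 s1) = 2^(-1/2), so two letters already give L 1 >= sqrt 2 > 1. *)
  set (s1 := ln 2 / (4 * ln (1 + M))).
  assert (Hs1 : 0 < s1) by (apply Rdiv_lt_0_compat; lra).
  assert (B1 : 1 < lambda m s1).
  { apply Rlt_le_trans with (2 * Rpower (1 + M) (- (2 * s1))).
    - unfold Rpower, s1. replace (- (2 * _) * _) with (- (ln 2 / 2)) by (field; lra).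
      apply Rle_lt_trans with (2 * exp (- ln 2)).
      + rewrite exp_Ropp, exp_ln; lra.
      + apply Rmult_lt_compat_l; [lra|]. apply exp_increasing. lra.
    - rewrite <- (nu_const m Hpos Hne s1 Hs1 (_ * _)). apply nu_le_all; try easy.
      + apply c1_bounded_const.
      + apply c1_bounded_Lop; try easy. apply c1_bounded_const.
      + intros y Hy. pose proof (Rpower_pos (1 + M) (- (2 * s1))).
        assert (T : forall j, In j m -> Rpower (1 + M) (- (2 * s1)) <= Rpower (y + INR j) (- (2 * s1)) * 1).
        { intros j Hj. rewrite Rmult_1_r. pose proof (letter_ge_1 m Hpos j Hj). specialize (HM j Hj).
          apply Rpower_base_anti; lra. }
        destruct m as [|i [|j l]]; simpl in Hlen; [lia|lia|]. unfold Lop. simpl.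
        pose proof (T i (or_introl eq_refl)). pose proof (T j (or_intror (or_introl eq_refl))).
        assert (0 <= lsum l (fun j => Rpower (y + INR j) (- (2 * s1)) * 1)).
        { apply lsum_nonneg. intros. rewrite Rmult_1_r. left; apply Rpower_pos. }
        unfold lsum in *. lra. }
  (* Chosen so that the bound of [lambda_decay] from s1 to t1 is exactly 1/2. *)
  set (t1 := s1 + ln (2 * lambda m s1) / ln 2).
  assert (Ht1 : s1 < t1).
  { unfold t1. assert (0 < ln (2 * lambda m s1) / ln 2); [|lra]. apply Rdiv_lt_0_compat; [|easy].
    rewrite <- ln_1. apply ln_increasing; lra. }
  assert (B2 : lambda m t1 < 1).
  { apply Rle_lt_trans with (Rpower 2 (- (t1 - s1)) * lambda m s1); [apply lambda_decay; lra|].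
    unfold t1, Rpower. replace (- (_ - _) * ln 2) with (- ln (2 * lambda m s1)) by (field; lra).
    rewrite exp_Ropp, exp_ln by lra. apply Rle_lt_trans with (/ 2); [right; field|]; lra. }
  destruct (Ranalysis5.IVT_interv (fun t => 1 - lambda m t) s1 t1) as (z & Hz & E); try lra.
  - intros t Ht. apply continuity_pt_minus; [apply continuity_pt_const; now intros ? ?|].
    apply continuity_pt_filterlim, lambda_continuous. lra.
  - exists z. split; lra.
Qed.

End Exponent.

(** * Cylinders *)

(** The continuants (Q_n, Q_(n-1)): [Th w] is the Moebius map with denominator
    [fst (den w) + snd (den w) * y] and determinant 1 or -1. These denominators therefore determine
    distances between image points, as in [Th_diff]. *)
Fixpoint den (w : list nat) : R * R :=
  match w with
  | nil => (1, 0)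
  | j :: w' => (INR j * fst (den w') + snd (den w'), fst (den w'))
  end.

Lemma den_bounds (w : list nat) :
  (forall j, In j w -> 1 <= INR j) -> 1 <= fst (den w) /\ 0 <= snd (den w) <= fst (den w).
Proof.
  induction w as [|j w IH]; intros H; simpl; [lra|].
  assert (Hj : 1 <= INR j) by (apply H; now left).
  destruct IH as (H1 & H2 & H3); [intros; apply H; now right|]. nra.
Qed.

Lemma Th_diff (w : list nat) (x y : R) :
  (forall j, In j w -> 1 <= INR j) -> 0 <= x <= 1 -> 0 <= y <= 1 ->
  Rabs (Th w x - Th w y)
  = Rabs (x - y) / ((fst (den w) + snd (den w) * x) * (fst (den w) + snd (den w) * y)).
Proof.
  revert x y. induction w as [|j w IH]; intros x y Hw Hx Hy; simpl; [field|].
  assert (Hj : 1 <= INR j) by (apply Hw; now left).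
  assert (Hw' : forall i, In i w -> 1 <= INR i) by (intros; apply Hw; now right).
  destruct (den_bounds w Hw') as (B1 & B2 & B3).
  rewrite IH by (try apply theta_bounds; easy).
  replace (theta j x - theta j y) with ((y - x) * / ((x + INR j) * (y + INR j)))
    by (unfold theta; field; lra).
  rewrite Rabs_mult, (Rabs_pos_eq (/ _)), (Rabs_minus_sym y x)
    by (left; apply Rinv_0_lt_compat; nra).
  unfold theta. field. repeat split; nra.
Qed.

Lemma Th_diff_le (w : list nat) (x y : R) :
  (forall j, In j w -> 1 <= INR j) -> 0 <= x <= 1 -> 0 <= y <= 1 ->
  Rabs (Th w x - Th w y) <= Rabs (x - y) / (fst (den w) * fst (den w)).
Proof.
  intros Hw Hx Hy. rewrite Th_diff by easy. destruct (den_bounds w Hw) as (B1 & B2 & B3).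
  apply Rmult_le_compat_l; [apply Rabs_pos|]. apply Rinv_le_contravar; [nra|].
  apply Rmult_le_compat; nra.
Qed.

(** As Q' <= Q, each factor Q + Q' x is at most 2 Q, whence the 4: bounded distortion of
    cylinders. *)
Lemma Th_diff_ge (w : list nat) (x y : R) :
  (forall j, In j w -> 1 <= INR j) -> 0 <= x <= 1 -> 0 <= y <= 1 ->
  Rabs (x - y) / (4 * (fst (den w) * fst (den w))) <= Rabs (Th w x - Th w y).
Proof.
  intros Hw Hx Hy. rewrite (Th_diff w x y) by easy. destruct (den_bounds w Hw) as (B1 & B2 & B3).
  apply Rmult_le_compat_l; [apply Rabs_pos|]. apply Rinv_le_contravar.
  - apply Rmult_lt_0_compat; nra.
  - replace (4 * (fst (den w) * fst (den w))) with ((2 * fst (den w)) * (2 * fst (den w))) by ring.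
    apply Rmult_le_compat; nra.
Qed.

(** Self-similarity of the limit points: since Q >= 1, [Th] of a prefix is 1-Lipschitz, so it
    commutes with the limit of the tail. *)
Lemma comp_theta_lim_tail (a : nat -> nat) (n : nat) (p q : R) :
  (forall i, 1 <= INR (a i)) -> 0 <= q <= 1 ->
  is_lim_seq (fun k => comp_theta a k 0) p ->
  is_lim_seq (fun k => comp_theta (fun i => a (n + i)%nat) k 0) q ->
  p = Th (prefix a n) q.
Proof.
  intros Ha Hq Hp Hk. assert (Z : 0 <= 0 <= 1) by lra.
  assert (Hw : forall j, In j (prefix a n) -> 1 <= INR j)
    by (intros; now apply (prefix_incl (fun j => 1 <= INR j) a n)).
  destruct (den_bounds _ Hw) as (B1 & _).
  apply (is_lim_seq_incr_n _ n) in Hp.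
  assert (L : is_lim_seq (fun k => comp_theta a (k + n) 0) (Th (prefix a n) q)).
  { apply (is_lim_seq_ext (fun k => Th (prefix a n) q
      + (Th (prefix a n) (comp_theta (fun i => a (n + i)%nat) k 0) - Th (prefix a n) q))).
    { intros k. rewrite Nat.add_comm, comp_theta_add, (comp_theta_Th a n). ring. }
    replace (Finite (Th (prefix a n) q)) with (Finite (Th (prefix a n) q + 0)) by (f_equal; ring).
    apply is_lim_seq_plus'; [apply is_lim_seq_const|]. apply is_lim_seq_abs_0.
    apply (is_lim_seq_le_le (fun _ => 0) _
             (fun k => Rabs (comp_theta (fun i => a (n + i)%nat) k 0 - q))).
    - intros k. split; [apply Rabs_pos|].
      assert (B : 0 <= comp_theta (fun i => a (n + i)%nat) k 0 <= 1) by now apply comp_theta_bounds.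
      eapply Rle_trans; [now apply Th_diff_le|]. apply Rle_div_l; [nra|].
      pose proof (Rabs_pos (comp_theta (fun i => a (n + i)%nat) k 0 - q)).
      assert (1 <= fst (den (prefix a n)) * fst (den (prefix a n))) by nra. nra.
    - apply is_lim_seq_const.
    - apply -> is_lim_seq_abs_0. replace (Finite 0) with (Finite (q - q)) by (f_equal; ring).
      apply is_lim_seq_minus'; [easy|apply is_lim_seq_const]. }
  apply is_lim_seq_unique in Hp. apply is_lim_seq_unique in L. rewrite Hp in L. now injection L.
Qed.

Fixpoint words (m : list nat) (n : nat) : list (list nat) :=
  match n with
  | O => nil :: nil
  | S n' => flat_map (fun w => map (fun j => j :: w) m) (words m n')
  end.

Lemma words_spec (m : list nat) (n : nat) (w : list nat) :
  In w (words m n) <-> length w = n /\ (forall j, In j w -> In j m).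
Proof.
  revert w. induction n as [|n IH]; intros w; simpl.
  - split.
    + intros [<-|[]]. now split.
    + intros [H _]. left. now destruct w.
  - rewrite in_flat_map. split.
    + intros (u & Hu & Hw). apply in_map_iff in Hw. destruct Hw as (j & <- & Hj).
      apply IH in Hu. destruct Hu as [<- Hu]. split; [easy|]. intros i [<-|Hi]; auto.
    + intros [H1 H2]. destruct w as [|j w]; [easy|]. exists w. split.
      * apply IH. split; [now injection H1|]. intros i Hi. apply H2. now right.
      * apply in_map_iff. exists j. split; [easy|]. apply H2. now left.
Qed.

Lemma lsum_app {A : Type} (l1 l2 : list A) (F : A -> R) :
  lsum (l1 ++ l2) F = lsum l1 F + lsum l2 F.
Proof. induction l1 as [|a l IH]; simpl; [|rewrite IH]; ring. Qed.

Lemma lsum_map {A B : Type} (f : A -> B) (l : list A) (F : B -> R) :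
  lsum (map f l) F = lsum l (fun a => F (f a)).
Proof. induction l as [|a l IH]; simpl; [|rewrite IH]; easy. Qed.

Lemma lsum_flat_map {A B : Type} (f : A -> list B) (l : list A) (F : B -> R) :
  lsum (flat_map f l) F = lsum l (fun a => lsum (f a) F).
Proof. induction l as [|a l IH]; simpl; [|rewrite lsum_app, IH]; easy. Qed.

(** * Hausdorff measure of the limit set *)

(** For an empty set the supremum is -oo, which [real] sends to 0; [0 <= c] covers this case. *)
Lemma diam_le (U : R -> Prop) (c : R) :
  0 <= c -> (forall x y, U x -> U y -> Rabs (x - y) <= c) -> diam U <= c.
Proof.
  intros Hc H. unfold diam.
  destruct (Lub_Rbar_correct (fun d => exists x y, U x /\ U y /\ d = Rabs (x - y))) as [_ Hl].
  assert (L : Rbar_le (Lub_Rbar (fun d => exists x y, U x /\ U y /\ d = Rabs (x - y))) c).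
  { apply Hl. intros d (x & y & Hx & Hy & ->). now apply H. }
  destruct (Lub_Rbar _); simpl in *; easy.
Qed.

(** Boundedness matters: a supremum +oo would be read by [real] as 0. *)
Lemma diam_ge (U : R -> Prop) (c x y : R) :
  (forall x y, U x -> U y -> Rabs (x - y) <= c) -> U x -> U y -> Rabs (x - y) <= diam U.
Proof.
  intros H Hx Hy. unfold diam.
  destruct (Lub_Rbar_correct (fun d => exists x y, U x /\ U y /\ d = Rabs (x - y))) as [Hu Hl].
  assert (L : Rbar_le (Lub_Rbar (fun d => exists x y, U x /\ U y /\ d = Rabs (x - y))) c).
  { apply Hl. intros d (x' & y' & Hx' & Hy' & ->). now apply H. }
  assert (G : Rbar_le (Rabs (x - y)) (Lub_Rbar (fun d => exists x y, U x /\ U y /\ d = Rabs (x - y)))).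
  { apply Hu. now exists x, y. }
  destruct (Lub_Rbar _); simpl in *; easy.
Qed.

Lemma dpow_nonneg (d s : R) : 0 <= dpow d s.
Proof. unfold dpow. destruct (Rle_dec d 0); [lra|left; apply Rpower_pos]. Qed.

Lemma dpow_le (d e s : R) : 0 <= s -> 0 < e -> d <= e -> dpow d s <= Rpower e s.
Proof.
  intros Hs He H. unfold dpow. destruct (Rle_dec d 0); [left; apply Rpower_pos|].
  apply Rle_Rpower_l; lra.
Qed.

Lemma dpow_ge (d e s : R) : 0 <= s -> 0 < e -> e <= d -> Rpower e s <= dpow d s.
Proof. intros Hs He H. unfold dpow. destruct (Rle_dec d 0); [lra|]. apply Rle_Rpower_l; lra. Qed.

Lemma sum_nth_error_le {A : Type} (l : list A) (F : A -> R) (N : nat) :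
  (forall a, In a l -> 0 <= F a) ->
  sum_f_R0 (fun i => match nth_error l i with Some a => F a | None => 0 end) N <= lsum l F.
Proof.
  revert N. induction l as [|a l IH]; intros N H.
  - rewrite (sum_eq _ (fun _ => 0)); [rewrite sum_eq_R0; [simpl; lra|easy]|].
    intros i _. now destruct i.
  - assert (0 <= F a) by (apply H; now left).
    assert (Hl : forall b, In b l -> 0 <= F b) by (intros; apply H; now right).
    destruct N as [|N]; simpl lsum.
    + simpl. pose proof (lsum_nonneg l F Hl). lra.
    + rewrite decomp_sum by lia. simpl. specialize (IH N Hl). lra.
Qed.

Lemma hausdorff_delta_nonneg (s delta : R) (A : R -> Prop) :
  Rbar_le 0 (hausdorff_delta s delta A).
Proof.
  unfold hausdorff_delta, Rbar_glb. destruct Rbar_ex_glb as [r [Hl Hg]]. cbn [proj1_sig].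
  apply Hg. intros t (U & _ & _ & ->). unfold rsum, Rbar_lub.
  destruct Rbar_ex_lub as [q [Hu Hm]]. cbn [proj1_sig].
  eapply Rbar_le_trans; [|apply Hu; now exists O]. rewrite sum_O. apply dpow_nonneg.
Qed.

Lemma hausdorff_measure_zero_intro (s : R) (A : R -> Prop) :
  (forall delta eps, 0 < delta -> 0 < eps -> exists U : nat -> R -> Prop,
     (forall x, A x -> exists i, U i x) /\
     (forall i x y, U i x -> U i y -> Rabs (x - y) <= delta) /\
     (forall N, sum_f_R0 (fun i => dpow (diam (U i)) s) N <= eps)) ->
  hausdorff_measure s A = Finite 0.
Proof.
  intros H.
  assert (D : forall delta, 0 < delta -> hausdorff_delta s delta A = Finite 0).
  { intros delta Hd. apply Rbar_le_antisym; [|apply hausdorff_delta_nonneg].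
    assert (E : forall eps, 0 < eps -> Rbar_le (hausdorff_delta s delta A) eps).
    { intros eps He. destruct (H delta eps Hd He) as (U & U1 & U2 & U3).
      unfold hausdorff_delta, Rbar_glb. destruct Rbar_ex_glb as [r [Hl Hg]]. cbn [proj1_sig].
      eapply Rbar_le_trans; [apply Hl; exists U; now repeat split|].
      unfold rsum, Rbar_lub. destruct Rbar_ex_lub as [q [Hu Hm]]. cbn [proj1_sig].
      apply Hm. intros t (N & ->). rewrite sum_n_Reals. apply U3. }
    destruct (hausdorff_delta s delta A) as [r| |]; simpl in *; try easy.
    - apply le_epsilon. intros eps He. specialize (E eps He). lra.
    - apply (E 1). lra. }
  unfold hausdorff_measure, Rbar_lub. destruct Rbar_ex_lub as [q [Hu Hm]]. cbn [proj1_sig].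
  apply Rbar_le_antisym.
  - apply Hm. intros t (delta & Hd & ->). rewrite D by easy. apply Rbar_le_refl.
  - apply Hu. exists 1. split; [lra|]. now rewrite D by lra.
Qed.

(** The measure is a supremum over scales, so if it is 0 then it is already 0 at scale 1, which is
    enough to find light covers. *)
Lemma hausdorff_measure_zero_elim (s eps : R) (A : R -> Prop) :
  0 < eps -> hausdorff_measure s A = Finite 0 -> exists U : nat -> R -> Prop,
     (forall x, A x -> exists i, U i x) /\
     (forall i x y, U i x -> U i y -> Rabs (x - y) <= 1) /\
     (forall N, sum_f_R0 (fun i => dpow (diam (U i)) s) N < eps).
Proof.
  intros He H. apply NNPP. intros C.
  assert (G : Rbar_le eps (hausdorff_delta s 1 A)).
  { unfold hausdorff_delta, Rbar_glb. destruct Rbar_ex_glb as [r [Hl Hg]]. cbn [proj1_sig].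
    apply Hg. intros t (U & U1 & U2 & ->).
    assert (B : exists N, eps <= sum_f_R0 (fun i => dpow (diam (U i)) s) N).
    { apply NNPP. intros C2. apply C. exists U. split; [easy|split; [easy|]]. intros N.
      apply Rnot_le_lt. intros L. apply C2. now exists N. }
    destruct B as [N HN]. unfold rsum, Rbar_lub. destruct Rbar_ex_lub as [q [Hu Hm]]. cbn [proj1_sig].
    eapply Rbar_le_trans; [|apply Hu; now exists N]. rewrite sum_n_Reals. exact HN. }
  revert H. unfold hausdorff_measure, Rbar_lub. destruct Rbar_ex_lub as [q [Hu Hm]]. cbn [proj1_sig]. intros ->.
  assert (L : Rbar_le eps 0).
  { eapply Rbar_le_trans; [apply G|]. apply Hu. exists 1. split; [lra|easy]. }
  simpl in L. lra.
Qed.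

Lemma lsum_at_most_one (l : list nat) (P : nat -> Prop) (e : R) :
  NoDup l -> 0 <= e -> (forall j k, In j l -> In k l -> P j -> P k -> j = k) ->
  lsum l (fun j => if excluded_middle_informative (P j) then e else 0) <= e.
Proof.
  intros Hnd He. induction Hnd as [|j l Hj Hnd IH]; intros H; simpl; [easy|].
  destruct (excluded_middle_informative (P j)) as [Pj|Pj].
  - rewrite (lsum_ext l _ (fun _ => 0 * 1)).
    + rewrite lsum_scal. lra.
    + intros k Hk. destruct (excluded_middle_informative (P k)) as [Pk|Pk]; [|ring].
      exfalso. apply Hj. rewrite (H j k); [easy|now left|now right|easy|easy].
  - rewrite Rplus_0_l. apply IH. intros i k Hi Hk. apply H; now right.
Qed.

Lemma sum_f_R0_lsum {A : Type} (l : list A) (F : A -> nat -> R) (N : nat) :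
  sum_f_R0 (fun i => lsum l (fun a => F a i)) N = lsum l (fun a => sum_f_R0 (F a) N).
Proof.
  induction N as [|N IH]; simpl; [easy|]. now rewrite IH, <- lsum_plus.
Qed.

Lemma sum_f_R0_mono (f : nat -> R) (N K : nat) :
  (forall i, 0 <= f i) -> (N <= K)%nat -> sum_f_R0 f N <= sum_f_R0 f K.
Proof.
  intros Hf HNK. induction HNK as [|K HNK IH]; [lra|]. simpl. specialize (Hf (S K)). lra.
Qed.

Lemma sum_f_R0_term_le (f : nat -> R) (i : nat) : (forall i, 0 <= f i) -> f i <= sum_f_R0 f i.
Proof.
  intros Hf. destruct i as [|i]; simpl; [lra|].
  pose proof (cond_pos_sum f i Hf). lra.
Qed.

(** * Cylinder weights and the two bounds for the dimension *)

Section LimitSet.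

Context (m : list nat) (Hpos : forall k, In k m -> (0 < k)%nat) (Hne : m <> nil).
Context (s lam : R) (v : R -> R) (Hs : 0 < s)
  (Hv : forall x, 0 <= x <= 1 -> Rpower 2 (- (2 * s)) <= v x <= 1) (Hv0 : v 0 = 1)
  (Heig : forall x, 0 <= x <= 1 -> Lop m s v x = lam * v x).

(* Comparable to the [s]-th power of the diameter of the cylinder [Th w [0, 1]]. *)
Definition weight (w : list nat) : R :=
  Rpower (fst (den w)) (- (2 * s)) * v (snd (den w) / fst (den w)).

Lemma letters_ge_1 (w : list nat) :
  (forall j, In j w -> In j m) -> forall j, In j w -> 1 <= INR j.
Proof. intros Hw j Hj. apply (letter_ge_1 m Hpos), Hw, Hj. Qed.

Lemma den_ratio_bounds (w : list nat) :
  (forall j, In j w -> In j m) -> 0 <= snd (den w) / fst (den w) <= 1.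
Proof.
  intros Hw. destruct (den_bounds w (letters_ge_1 w Hw)) as (B1 & B2 & B3). split.
  - apply Rmult_le_pos; [easy|]. left; apply Rinv_0_lt_compat; lra.
  - apply Rle_div_l; lra.
Qed.

Lemma weight_bounds (w : list nat) :
  (forall j, In j w -> In j m) ->
  Rpower 2 (- (2 * s)) * Rpower (fst (den w)) (- (2 * s)) <= weight w
    <= Rpower (fst (den w)) (- (2 * s)).
Proof.
  intros Hw. pose proof (Hv _ (den_ratio_bounds w Hw)).
  pose proof (Rpower_pos (fst (den w)) (- (2 * s))). unfold weight. nra.
Qed.

Lemma weight_pos (w : list nat) : (forall j, In j w -> In j m) -> 0 < weight w.
Proof.
  intros Hw. eapply Rlt_le_trans; [|apply (weight_bounds w Hw)].
  apply Rmult_lt_0_compat; apply Rpower_pos.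
Qed.

(** Put z = Q'/Q. The child's denominator is Q (z + j) and its ratio is Q / (j Q + Q') =
    [theta j z], so the sum is Q^(-2s) (L v)(z). *)
Lemma weight_children (w : list nat) :
  (forall j, In j w -> In j m) -> lsum m (fun j => weight (j :: w)) = lam * weight w.
Proof.
  intros Hw. destruct (den_bounds w (letters_ge_1 w Hw)) as (B1 & B2 & B3).
  unfold weight at 2. rewrite (Rmult_comm (Rpower _ _)), <- Rmult_assoc,
    <- Heig, Rmult_comm by now apply den_ratio_bounds.
  change (Lop m s v (snd (den w) / fst (den w)))
    with (lsum m (fun j => Rpower (snd (den w) / fst (den w) + INR j) (- (2 * s))
                           * v (theta j (snd (den w) / fst (den w))))).
  rewrite <- lsum_scal. apply lsum_ext. intros j Hj. pose proof (letter_ge_1 m Hpos j Hj).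
  unfold weight. simpl. rewrite <- Rmult_assoc, Rpower_mult_distr.
  - f_equal; [f_equal; field; lra|]. f_equal. unfold theta. field. split; nra.
  - lra.
  - pose proof (den_ratio_bounds w Hw). lra.
Qed.

Lemma weight_words (n : nat) : lsum (words m n) weight = lam ^ n.
Proof.
  induction n as [|n IH]; simpl.
  - unfold weight. simpl. unfold Rpower, Rdiv.
    rewrite ln_1, Rmult_0_r, exp_0, Rmult_0_l, Hv0. ring.
  - rewrite lsum_flat_map, (lsum_ext _ _ (fun w => lam * weight w)).
    + now rewrite lsum_scal, IH.
    + intros w Hw. rewrite lsum_map. apply weight_children. now apply (words_spec m n).
Qed.

Definition cylinder (w : list nat) (x : R) : Prop := exists y, 0 <= y <= 1 /\ x = Th w y.

Lemma dpow_diam_cylinder (w : list nat) :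
  (forall j, In j w -> In j m) -> dpow (diam (cylinder w)) s <= Rpower 2 (2 * s) * weight w.
Proof.
  intros Hw. pose proof (letters_ge_1 w Hw) as Hw1.
  destruct (den_bounds w Hw1) as (B1 & _). destruct (weight_bounds w Hw) as [W _].
  apply Rle_trans with (Rpower (fst (den w)) (- (2 * s))).
  - assert (P : 0 < / (fst (den w) * fst (den w))) by (apply Rinv_0_lt_compat; nra).
    apply Rle_trans with (Rpower (/ (fst (den w) * fst (den w))) s).
    + apply dpow_le; [lra|easy|]. apply diam_le; [lra|]. intros x y (x' & Hx & ->) (y' & Hy & ->).
      eapply Rle_trans; [now apply Th_diff_le|].
      unfold Rdiv. rewrite <- (Rmult_1_l (/ _)) at 2. apply Rmult_le_compat_r; [lra|].
      apply Rabs_le_between. lra.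
    + right. unfold Rpower. f_equal. rewrite ln_Rinv, ln_mult by nra. ring.
  - apply Rle_trans with (Rpower 2 (2 * s) * (Rpower 2 (- (2 * s)) * Rpower (fst (den w)) (- (2 * s)))).
    + rewrite <- Rmult_assoc, <- Rpower_plus, Rplus_opp_r, Rpower_O by lra. lra.
    + apply Rmult_le_compat_l; [left; apply Rpower_pos|easy].
Qed.

Lemma hausdorff_measure_cantorE_zero :
  0 < lam -> lam < 1 -> hausdorff_measure s (cantorE m) = Finite 0.
Proof.
  intros L0 L1. apply hausdorff_measure_zero_intro. intros delta eps Hd He.
  assert (Hn : exists n, 4 * (4 / 9) ^ n <= delta /\ Rpower 2 (2 * s) * lam ^ n <= eps).
  { pose proof (geom_4_9 4) as G1.
    assert (G2 : is_lim_seq (fun n => Rpower 2 (2 * s) * lam ^ n) 0).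
    { rewrite <- (Rmult_0_r (Rpower 2 (2 * s))).
      apply is_lim_seq_mult'; [apply is_lim_seq_const|].
      apply is_lim_seq_geom. rewrite Rabs_pos_eq; lra. }
    apply is_lim_seq_spec in G1. apply is_lim_seq_spec in G2.
    destruct (G1 (mkposreal _ Hd)) as [N1 H1], (G2 (mkposreal _ He)) as [N2 H2].
    exists (max N1 N2). specialize (H1 (max N1 N2) (Nat.le_max_l _ _)).
    specialize (H2 (max N1 N2) (Nat.le_max_r _ _)). simpl in H1, H2.
    rewrite Rminus_0_r in H1, H2. apply Rabs_lt_between in H1. apply Rabs_lt_between in H2. lra. }
  destruct Hn as (n & N1 & N2).
  set (U := fun i x => match nth_error (words m n) i with
                       | Some w => cylinder w x | None => False end).
  exists U. split; [|split].
  - intros x (a & Ha & Hx).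
    assert (Ha1 : forall i, 1 <= INR (a i)) by (intros; now apply (letter_ge_1 m)).
    destruct (comp_theta_lim (fun i => a (n + i)%nat)) as (q & Hq & Lq); [easy|].
    assert (E : x = Th (prefix a n) q).
    { apply comp_theta_lim_tail; try easy. apply Lq. lra. }
    assert (Hw : In (prefix a n) (words m n)).
    { apply words_spec. split; [apply length_prefix|]. now apply (prefix_incl (fun j => In j m)). }
    apply In_nth_error in Hw. destruct Hw as [i Hi]. exists i. unfold U. rewrite Hi. now exists q.
  - intros i x y. unfold U. destruct (nth_error (words m n) i) as [w|] eqn:E; [|easy].
    intros (x' & Hx & ->) (y' & Hy & ->). apply nth_error_In, words_spec in E.
    destruct E as [E1 E2]. eapply Rle_trans; [|apply N1]. rewrite <- E1.
    apply Th_contract; try easy. now apply letters_ge_1.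
  - intros N. eapply Rle_trans; [|apply N2]. rewrite <- weight_words, <- lsum_scal.
    eapply Rle_trans; [|apply (sum_nth_error_le (words m n) _ N)].
    + apply sum_Rle. intros i _. unfold U.
      destruct (nth_error (words m n) i) as [w|] eqn:E.
      * apply dpow_diam_cylinder. apply nth_error_In, words_spec in E. easy.
      (* Indices beyond the list of words give empty sets, which contribute 0 by the convention in
         [dpow]. *)
      * unfold dpow. destruct (Rle_dec _ 0) as [|F]; [lra|]. exfalso. apply F.
        now apply diam_le; [lra|].
    + intros w Hw. apply Rmult_le_pos; [left; apply Rpower_pos|]. left. apply weight_pos.
      now apply (words_spec m n).
Qed.

(* The hull [[alpha, beta]] of the limit set is used instead of [[0, 1]] because its images
   under distinct letters are at positive distance. *)
Section LowerBound.

Context (Hnd : NoDup m) (Hlam : 1 <= lam)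
  (M : R) (HM1 : 1 <= M) (HM : forall j, In j m -> INR j <= M)
  (U : nat -> R -> Prop) (Ucov : forall x, cantorE m x -> exists i, U i x)
  (Ubd : forall i x y, U i x -> U i y -> Rabs (x - y) <= 1).

(** [alpha] bounds every [theta j] on [0,1] from below, and [beta] is 1 / (1 + alpha), the value of
    [theta 1] at [alpha]. [gap] is alpha / (M + 1)^2: distinct letters shift the hull by at least 1,
    the hull is shorter than 1 - alpha, and inversion costs at most (M + 1)^2. *)
Let alpha := / (M + 1).
Let beta := (M + 1) / (M + 2).
Let gap := / ((M + 1) * ((M + 1) * (M + 1))).

Lemma hull_bounds : 0 < alpha /\ alpha <= beta /\ beta < 1.
Proof.
  unfold alpha, beta. split; [apply Rinv_0_lt_compat; lra|split].
  - apply Rle_div_r; [lra|]. apply (Rmult_le_reg_l (M + 1)); [lra|].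
    rewrite <- Rmult_assoc, Rinv_r by lra. nra.
  - apply Rlt_div_l; lra.
Qed.

Lemma theta_hull (j : nat) (y : R) :
  In j m -> alpha <= y <= beta -> alpha <= theta j y <= beta.
Proof.
  intros Hj Hy. pose proof hull_bounds as (A1 & A2 & A3).
  pose proof (letter_ge_1 m Hpos j Hj). specialize (HM j Hj). unfold theta. split.
  - apply Rinv_le_contravar; lra.
  - replace beta with (/ (alpha + 1)) by (unfold alpha, beta; field; lra).
    apply Rinv_le_contravar; lra.
Qed.

Lemma theta_gap (j k : nat) (y z : R) :
  In j m -> In k m -> j <> k -> alpha <= y <= beta -> alpha <= z <= beta ->
  gap <= Rabs (theta j y - theta k z).
Proof.
  intros Hj Hk Hjk Hy Hz. pose proof hull_bounds as (A1 & A2 & A3).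
  pose proof (letter_ge_1 m Hpos j Hj). pose proof (letter_ge_1 m Hpos k Hk).
  pose proof (HM j Hj). pose proof (HM k Hk).
  replace (theta j y - theta k z) with ((z + INR k - (y + INR j)) * / ((y + INR j) * (z + INR k)))
    by (unfold theta; field; lra).
  rewrite Rabs_mult, (Rabs_pos_eq (/ _)) by (left; apply Rinv_0_lt_compat; nra).
  unfold gap. rewrite Rinv_mult. apply Rmult_le_compat.
  - left; apply Rinv_0_lt_compat; lra.
  - left; apply Rinv_0_lt_compat; nra.
  - assert (B : beta - alpha <= 1 - alpha).
    { lra. }
    assert (E : INR j + 1 <= INR k \/ INR k + 1 <= INR j).
    { destruct (Nat.lt_gt_cases j k) as [T _]. destruct (T Hjk) as [L|L]; [left|right];
        rewrite <- S_INR; apply le_INR; lia. }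
    change (alpha <= Rabs (z + INR k - (y + INR j))).
    destruct E as [E|E]; [rewrite Rabs_pos_eq|rewrite Rabs_left]; lra.
  - apply Rinv_le_contravar; [nra|]. apply Rmult_le_compat; lra.
Qed.

Lemma gap_pos : 0 < gap.
Proof. apply Rinv_0_lt_compat. repeat apply Rmult_lt_0_compat; lra. Qed.

(** The first letter gives the lower bound for every limit point; the lower bound for the tail then
    gives the upper bound. *)
Lemma lim_hull (a : nat -> nat) (p : R) :
  (forall i, In (a i) m) -> is_lim_seq (fun n => comp_theta a n 0) p -> alpha <= p <= beta.
Proof.
  intros Ha Hp. pose proof hull_bounds as (A1 & A2 & A3).
  assert (Step : forall b (q : R), (forall i, In (b i) m) ->
    is_lim_seq (fun n => comp_theta b n 0) q ->
    exists q', 0 <= q' <= 1 /\ q = theta (b O) q' /\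
      is_lim_seq (fun n => comp_theta (fun i => b (1 + i)%nat) n 0) q').
  { intros b q Hb Hq.
    assert (Hb1 : forall i, 1 <= INR (b i)) by (intros; now apply (letter_ge_1 m)).
    destruct (comp_theta_lim (fun i => b (1 + i)%nat)) as (q' & Hq' & Lq); [easy|].
    exists q'. split; [easy|]. assert (Z : 0 <= 0 <= 1) by lra. split; [|now apply Lq].
    apply (comp_theta_lim_tail b 1 q q'); try easy. now apply Lq. }
  assert (Low : forall b (q : R), (forall i, In (b i) m) ->
    is_lim_seq (fun n => comp_theta b n 0) q -> alpha <= q).
  { intros b q Hb Hq. destruct (Step b q Hb Hq) as (q' & Hq' & -> & _).
    pose proof (letter_ge_1 m Hpos _ (Hb O)). pose proof (HM _ (Hb O)).
    unfold theta. apply Rinv_le_contravar; lra. }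
  split; [now apply (Low a)|].
  destruct (Step a p Ha Hp) as (q & Hq & -> & Lq).
  apply Low in Lq; [|intros; apply Ha].
  pose proof (letter_ge_1 m Hpos _ (Ha O)). unfold theta.
  replace beta with (/ (alpha + 1)) by (unfold alpha, beta; field; lra).
  apply Rinv_le_contravar; lra.
Qed.

(** Two children of w are at distance at least (gap / 4) Q^(-2), whose s-th power is c Q^(-2s) >= c
    times the weight of w. *)
Let c := Rpower (gap / 4) s.

Context (Hsum : forall N, sum_f_R0 (fun i => dpow (diam (U i)) s) N < c / 2).

Definition meets (w : list nat) (i : nat) : Prop := exists y, alpha <= y <= beta /\ U i (Th w y).

(* The summable correction keeps the mass of a one-point set positive. *)
Definition mass (i : nat) : R := dpow (diam (U i)) s + (/ 2) ^ i * (c / 4).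

Definition met_mass (w : list nat) (i : nat) : R :=
  if excluded_middle_informative (meets w i) then mass i else 0.

Definition undercovered (w : list nat) : Prop :=
  forall N, sum_f_R0 (met_mass w) N < c * weight w.

Lemma c_pos : 0 < c.
Proof. apply Rpower_pos. Qed.

Lemma mass_pos (i : nat) : 0 < mass i.
Proof.
  unfold mass. pose proof (dpow_nonneg (diam (U i)) s). pose proof c_pos.
  pose proof (pow_lt (/ 2) i ltac:(lra)). nra.
Qed.

Lemma met_mass_nonneg (w : list nat) (i : nat) : 0 <= met_mass w i.
Proof.
  unfold met_mass. destruct (excluded_middle_informative _); [left; apply mass_pos|lra].
Qed.

Lemma mass_of_met (w : list nat) (i : nat) :
  undercovered w -> meets w i -> mass i < c * weight w.
Proof.
  intros Hu Hi. eapply Rle_lt_trans; [|apply (Hu i)].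
  replace (mass i) with (met_mass w i).
  - apply sum_f_R0_term_le. apply met_mass_nonneg.
  - unfold met_mass. now destruct (excluded_middle_informative _).
Qed.

(** The cover spends less than c/2 and the geometric correction less than 2 (c/4) = c/2, while the
    empty word has weight 1. *)
Lemma undercovered_root : undercovered nil.
Proof.
  intros N. pose proof c_pos.
  apply Rle_lt_trans with (sum_f_R0 (fun i => dpow (diam (U i)) s + (/ 2) ^ i * (c / 4)) N).
  - apply sum_Rle. intros i _. unfold met_mass. destruct (excluded_middle_informative _);
      [unfold mass; lra|left; apply mass_pos].
  - rewrite plus_sum, <- scal_sum. specialize (Hsum N).
    rewrite tech3 by lra.
    replace (weight nil) with 1.
    + pose proof (pow_lt (/ 2) (S N) ltac:(lra)).
      replace (1 - / 2) with (/ 2) by field. unfold Rdiv. rewrite Rinv_inv. nra.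
    + unfold weight. simpl. unfold Rpower, Rdiv.
      rewrite ln_1, Rmult_0_r, exp_0, Rmult_0_l, Hv0. ring.
Qed.

(* A set meeting two children of [w] has diameter at least that of the gap between them, hence
   mass at least [c * weight w]. *)
Lemma met_mass_children (w : list nat) (i : nat) :
  (forall j, In j w -> In j m) -> undercovered w ->
  lsum m (fun j => met_mass (j :: w) i) <= met_mass w i.
Proof.
  intros Hw Hu. pose proof (letters_ge_1 w Hw) as Hw1. pose proof hull_bounds as (A1 & A2 & A3).
  assert (Up : forall j, In j m -> meets (j :: w) i -> meets w i).
  { intros j Hj (y & Hy & H). exists (theta j y). split; [now apply theta_hull|easy]. }
  unfold met_mass at 2. destruct (excluded_middle_informative (meets w i)) as [Hm|Hm].
  - apply (lsum_at_most_one m (fun j => meets (j :: w) i)); [easy|left; apply mass_pos|].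
    intros j k Hj Hk (y & Hy & Uy) (z & Hz & Uz). apply NNPP. intros Hjk.
    pose proof (theta_hull j y Hj Hy). pose proof (theta_hull k z Hk Hz).
    pose proof (theta_gap j k y z Hj Hk Hjk Hy Hz) as Hg. pose proof gap_pos.
    destruct (den_bounds w Hw1) as (B1 & _).
    assert (D : gap / 4 * / (fst (den w) * fst (den w)) <= diam (U i)).
    { eapply Rle_trans; [|apply (diam_ge (U i) 1 _ _ (Ubd i) Uy Uz)]. simpl.
      eapply Rle_trans; [|apply Th_diff_ge; [easy|lra|lra]].
      replace (gap / 4 * / (fst (den w) * fst (den w)))
        with (gap * / (4 * (fst (den w) * fst (den w)))) by (field; lra).
      apply Rmult_le_compat_r; [|easy]. left; apply Rinv_0_lt_compat; nra. }
    assert (P : 0 < / (fst (den w) * fst (den w))) by (apply Rinv_0_lt_compat; nra).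
    apply (dpow_ge _ _ s) in D; [|lra|apply Rmult_lt_0_compat; lra].
    rewrite <- Rpower_mult_distr in D by lra. fold c in D.
    replace (Rpower (/ (fst (den w) * fst (den w))) s) with (Rpower (fst (den w)) (- (2 * s))) in D
      by (unfold Rpower; f_equal; rewrite ln_Rinv, ln_mult by nra; ring).
    pose proof (mass_of_met w i Hu Hm) as L. destruct (weight_bounds w Hw) as [_ W].
    pose proof c_pos. pose proof (pow_lt (/ 2) i ltac:(lra)). unfold mass in L.
    assert (c * weight w <= c * Rpower (fst (den w)) (- (2 * s))) by (apply Rmult_le_compat_l; lra).
    assert (0 < (/ 2) ^ i * (c / 4)) by (apply Rmult_lt_0_compat; lra). lra.
  - right. rewrite (lsum_ext m _ (fun _ => 0 * 1)); [rewrite lsum_scal; ring|].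
    intros j Hj. unfold met_mass. destruct (excluded_middle_informative _) as [Hc|]; [|ring].
    exfalso. apply Hm. now apply (Up j).
Qed.

(** Otherwise every child j is charged at least c times its weight. Summing over j gives at least c
    lam times the weight of w, which is where lam >= 1 enters, while [met_mass_children] says that
    the children are charged no more than w itself. *)
Lemma undercovered_child (w : list nat) :
  (forall j, In j w -> In j m) -> undercovered w -> exists j, In j m /\ undercovered (j :: w).
Proof.
  intros Hw Hu. apply NNPP. intros C.
  (* Partial sums increase, so the finitely many letters share one index N. *)
  assert (E : exists N, forall j, In j m -> c * weight (j :: w) <= sum_f_R0 (met_mass (j :: w)) N).
  { assert (E : forall l, incl l m ->
      exists N, forall j, In j l -> c * weight (j :: w) <= sum_f_R0 (met_mass (j :: w)) N).
    { intros l. induction l as [|j l IH]; intros Hl; [now exists O|].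
      destruct IH as [N HN]; [intros i Hi; apply Hl; now right|].
      assert (Ej : exists K, c * weight (j :: w) <= sum_f_R0 (met_mass (j :: w)) K).
      { apply NNPP. intros C2. apply C. exists j. split; [apply Hl; now left|].
        intros K. apply Rnot_le_lt. intros L. apply C2. now exists K. }
      destruct Ej as [K HK]. exists (max N K). intros i [<-|Hi].
      - eapply Rle_trans; [apply HK|]. apply sum_f_R0_mono; [apply met_mass_nonneg|lia].
      - eapply Rle_trans; [now apply HN|]. apply sum_f_R0_mono; [apply met_mass_nonneg|lia]. }
    apply E. now intros ?. }
  destruct E as [N HN]. apply (Rlt_irrefl (c * weight w)).
  pose proof c_pos. pose proof (weight_pos w Hw).
  apply Rle_lt_trans with (sum_f_R0 (met_mass w) N); [|apply Hu].
  apply Rle_trans with (lsum m (fun j => c * weight (j :: w))).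
  - rewrite lsum_scal, weight_children by easy. apply Rmult_le_compat_l; [lra|nra].
  - apply Rle_trans with (lsum m (fun j => sum_f_R0 (met_mass (j :: w)) N)).
    + now apply lsum_le.
    + rewrite <- sum_f_R0_lsum. apply sum_Rle. intros i _. now apply met_mass_children.
Qed.

Lemma undercovered_branch :
  exists a : nat -> nat, (forall i, In (a i) m) /\ forall n, undercovered (prefix a n).
Proof.
  (* The conditions on w stand inside the existential, so that choice yields a step defined on all
     words. *)
  assert (H : forall w, exists j, In j m /\
    ((forall i, In i w -> In i m) -> undercovered w -> undercovered (j :: w))).
  { intros w. destruct (classic ((forall i, In i w -> In i m) /\ undercovered w)) as [[H1 H2]|H].
    - destruct (undercovered_child w H1 H2) as (j & Hj & Hu). now exists j.
    - destruct m as [|j l]; [easy|]. exists j. split; [now left|]. intros. exfalso. now apply H. }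
  set (step := fun w => proj1_sig (constructive_indefinite_description _ (H w))).
  assert (Hstep : forall w, In (step w) m /\
    ((forall i, In i w -> In i m) -> undercovered w -> undercovered (step w :: w))).
  { intros w. unfold step. now destruct constructive_indefinite_description. }
  set (chain := fun n => Nat.iter n (fun w => step w :: w) nil).
  set (a := fun n => step (chain n)).
  assert (Ha : forall i, In (a i) m) by (intros; apply Hstep).
  assert (E : forall n, prefix a n = chain n).
  { intros n. induction n as [|n IH]; simpl; [easy|]. now rewrite IH. }
  exists a. split; [easy|]. intros n. induction n as [|n IH]; [apply undercovered_root|].
  simpl. unfold a at 1. rewrite <- E. apply Hstep; [|easy].
  now apply (prefix_incl (fun j => In j m)).
Qed.

Lemma light_cover_absurd : False.
Proof.
  destruct undercovered_branch as (a & Ha & Hu). assert (Z : 0 <= 0 <= 1) by lra.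
  assert (Ha1 : forall i, 1 <= INR (a i)) by (intros; now apply (letter_ge_1 m)).
  destruct (comp_theta_lim a Ha1) as (p & Hp & Lp).
  destruct (Ucov p) as [i Hi]; [exists a; split; [easy|now apply Lp]|].
  pose proof c_pos as Pc. pose proof (mass_pos i) as Pm.
  assert (Hmeet : forall n, meets (prefix a n) i).
  { intros n. destruct (comp_theta_lim (fun k => a (n + k)%nat)) as (q & Hq & Lq); [easy|].
    exists q. split; [apply (lim_hull (fun k => a (n + k)%nat)); [easy|now apply Lq]|].
    rewrite <- (comp_theta_lim_tail a n p q); try easy; [now apply Lp|now apply Lq]. }
  (* Once Q^(-2) <= r, the weight is at most Q^(-2s) <= mass i / c, against [mass_of_met]. That r is
     a usable threshold relies on the mass being positive. *)
  set (r := Rpower (mass i / c) (/ s)).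
  assert (Hr : 0 < r) by apply Rpower_pos.
  pose proof (geom_4_9 8) as G. apply is_lim_seq_spec in G.
  destruct (G (mkposreal _ Hr)) as [n Hn]. specialize (Hn n (Nat.le_refl n)). simpl in Hn.
  rewrite Rminus_0_r in Hn. apply Rabs_lt_between in Hn.
  set (w := prefix a n). assert (Hw : forall j, In j w -> In j m).
  { now apply (prefix_incl (fun j => In j m)). }
  pose proof (letters_ge_1 w Hw) as Hw1. destruct (den_bounds w Hw1) as (B1 & B2 & B3).
  assert (O : 0 <= 1 <= 1) by lra.
  (* The image of [0,1] has length exactly 1 / (Q (Q + Q')) >= 1 / (2 Q^2), so its contraction
     forces Q^(-2) <= 8 (4/9)^n. *)
  pose proof (Th_contract w 0 1 Hw1 Z O) as T. rewrite Th_diff in T by easy.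
  unfold w at 5 in T. rewrite length_prefix, Rminus_0_l, Rabs_Ropp, Rabs_R1 in T.
  assert (B : / (fst (den w) * fst (den w)) <= r).
  { apply Rle_trans with (8 * (4 / 9) ^ n); [|lra].
    apply Rle_trans with (2 * (1 / ((fst (den w) + snd (den w) * 0) * (fst (den w) + snd (den w) * 1))));
      [|lra].
    replace (/ (fst (den w) * fst (den w)))
      with (2 * (1 / (fst (den w) * (fst (den w) * 2)))) by (field; lra).
    apply Rmult_le_compat_l; [lra|]. apply Rmult_le_compat_l; [lra|].
    apply Rinv_le_contravar; [nra|]. rewrite Rmult_0_r, Rplus_0_r.
    apply Rmult_le_compat_l; lra. }
  assert (P : 0 < / (fst (den w) * fst (den w))) by (apply Rinv_0_lt_compat; nra).
  pose proof (Rle_Rpower_l _ _ s (Rlt_le _ _ Hs) (conj P B)) as R1.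
  replace (Rpower (/ (fst (den w) * fst (den w))) s) with (Rpower (fst (den w)) (- (2 * s))) in R1
    by (unfold Rpower; f_equal; rewrite ln_Rinv, ln_mult by nra; ring).
  unfold r in R1. rewrite Rpower_mult, Rinv_l, Rpower_1 in R1
    by (lra || now apply Rdiv_lt_0_compat).
  pose proof (mass_of_met w i (Hu n) (Hmeet n)) as L. destruct (weight_bounds w Hw) as [_ W].
  assert (c * weight w <= c * (mass i / c)) by (apply Rmult_le_compat_l; lra).
  replace (c * (mass i / c)) with (mass i) in * by (field; lra). lra.
Qed.

End LowerBound.

Lemma hausdorff_measure_cantorE_nonzero :
  NoDup m -> 1 <= lam -> hausdorff_measure s (cantorE m) <> Finite 0.
Proof.
  intros Hnd Hlam H0. destruct (letter_bounded m) as (M & HM1 & HM).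
  assert (P : 0 < Rpower (/ ((M + 1) * ((M + 1) * (M + 1))) / 4) s / 2).
  { pose proof (Rpower_pos (/ ((M + 1) * ((M + 1) * (M + 1))) / 4) s). lra. }
  destruct (hausdorff_measure_zero_elim s _ (cantorE m) P H0) as (U & U1 & U2 & U3).
  exact (light_cover_absurd Hnd Hlam M HM1 HM U U1 U2 U3).
Qed.

End LimitSet.

(** * The smallest letter and the assembly of the theorem *)

Lemma listmin_In (m : list nat) : m <> nil -> In (listmin m) m.
Proof.
  destruct m as [|a l]; [easy|]. intros _. simpl.
  assert (H : forall l, fold_right Nat.min a l = a \/ In (fold_right Nat.min a l) l).
  { clear. induction l as [|b l IH]; simpl; [now left|].
    destruct (Nat.min_spec b (fold_right Nat.min a l)) as [[_ E]|[_ E]]; rewrite E; tauto. }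
  destruct (H l) as [->|H']; [now left|now right].
Qed.

Lemma listmin_le (m : list nat) (j : nat) : In j m -> (listmin m <= j)%nat.
Proof.
  destruct m as [|a l]; [easy|]. simpl.
  assert (H : forall l, (fold_right Nat.min a l <= a)%nat /\
                        forall j, In j l -> (fold_right Nat.min a l <= j)%nat).
  { clear. induction l as [|b l [IH1 IH2]]; simpl; [easy|]. split; [lia|].
    intros j [<-|Hj]; [lia|]. specialize (IH2 j Hj). lia. }
  intros [<-|Hj]; [apply (proj1 (H l))|now apply (proj2 (H l))].
Qed.

Lemma rising_pos (a : R) (k : nat) : 0 < a -> 0 < rising a k.
Proof.
  intros Ha. induction k as [|k IH]; simpl; [lra|].
  apply Rmult_lt_0_compat; [easy|]. pose proof (pos_INR k). lra.
Qed.

Theorem theorem3p1 (m : list nat)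
  (Hnd : NoDup m) (Hpos : forall k, In k m -> (0 < k)%nat) (Hne : m <> nil) :
  exists (lam : R -> R) (v : R -> R -> R),
    (forall s, 0 < s ->
       0 < lam s /\
       cont01 (v s) /\
       (forall x, 0 <= x <= 1 -> 0 < v s x) /\
       (forall x, 0 <= x <= 1 -> Lop m s (v s) x = lam s * v s x) /\
       (forall (w : R -> R) (mu : R), cont01 w ->
          (forall x, 0 <= x <= 1 -> 0 < w x) ->
          (forall x, 0 <= x <= 1 -> Lop m s w x = mu * w x) ->
          exists c, 0 < c /\ forall x, 0 <= x <= 1 -> w x = c * v s x) /\
       is_spectral_radius (Lop m s) (lam s) /\
       (exists eps, 0 < eps /\
          forall k x, - eps < x < 1 + eps -> ex_derive_n (v s) k x) /\
       (forall k x, (1 <= k)%nat -> 0 <= x <= 1 ->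
          0 < (-1) ^ k * Derive_n (v s) k x /\
          Rabs (Derive_n (v s) k x)
            <= rising (2 * s) k * / (INR (listmin m)) ^ k * v s x)) /\
    (forall s t, 0 < s -> s < t -> lam t < lam s) /\
    (forall s, 0 < s -> continuous lam s) /\
    ((2 <= length m)%nat ->
       exists s0, 0 < s0 /\ lam s0 = 1 /\
         (forall s, 0 < s -> lam s = 1 -> s = s0) /\
         hausdorff_dim (cantorE m) = Finite s0).
Proof.
  exists (lambda m), (fun s => eigf m s 0). split; [|split; [|split]].
  - intros s Hs. split; [now apply lambda_pos|]. split; [now apply cont01_eigf|].
    split; [now apply eigf_pos|]. split; [now apply eigf_eigen|].
    split.
    { intros w mu Cw Pw Ew. apply (positive_eigenfunction_unique m s (lambda m s) mu); try easy.
      - now apply cont01_eigf.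
      - now apply eigf_pos.
      - now apply eigf_eigen. }
    split; [now apply is_spectral_radius_lambda|]. split.
    { exists (/ 2). split; [lra|]. intros k x Hx. apply ex_derive_n_eigf; [easy..|lra]. }
    intros k x Hk Hx. rewrite Derive_n_eigf by (easy || lra).
    pose proof (eigf_pos m Hpos Hne s Hs k x Hx) as P.
    assert (Hr : 0 < rising (2 * s) k) by (apply rising_pos; lra).
    assert (Hg : 1 <= INR (listmin m)).
    { apply (letter_ge_1 m Hpos). now apply listmin_In. }
    split.
    + rewrite <- !Rmult_assoc, <- Rpow_mult_distr.
      replace (-1 * -1) with 1 by ring. rewrite pow1, Rmult_1_l.
      now apply Rmult_lt_0_compat.
    + rewrite !Rabs_mult, pow_1_abs, Rmult_1_l, !Rabs_pos_eq by lra.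
      rewrite Rmult_assoc. apply Rmult_le_compat_l; [lra|].
      apply eigf_le_min_letter; try easy; [lra|].
      intros j Hj. now apply le_INR, listmin_le.
  - intros s t Hs Hst. now apply lambda_decreasing.
  - intros s Hs. now apply lambda_continuous.
  - intros Hlen. destruct (lambda_crosses_one m Hpos Hne Hlen) as (s0 & Hs0 & E0).
    exists s0. split; [easy|]. split; [easy|]. split.
    { intros s Hs E. destruct (Rtotal_order s s0) as [L|[L|L]]; [|easy|].
      - pose proof (lambda_decreasing m Hpos Hne s s0 Hs L). lra.
      - pose proof (lambda_decreasing m Hpos Hne s0 s Hs0 L). lra. }
    unfold hausdorff_dim, Rbar_glb. destruct Rbar_ex_glb as [r [Hl Hg]]. cbn [proj1_sig].
    apply Rbar_le_antisym.
    (* Every s above s0 has eigenvalue below 1, hence measure zero; letting s decrease to s0 bounds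
       the infimum. *)
    + assert (E : forall s, s0 < s -> Rbar_le r s).
      { intros s Hs. apply Hl. exists s. split; [lra|]. split; [easy|].
        assert (Ps : 0 < s) by lra.
        apply (hausdorff_measure_cantorE_zero m Hpos s (lambda m s) (eigf m s 0) Ps).
        - now apply eigf_bounds.
        - now apply eigf_at_0.
        - now apply eigf_eigen.
        - now apply lambda_pos.
        - rewrite <- E0. now apply lambda_decreasing. }
      destruct r as [r| |]; simpl in *; [|apply (E (s0 + 1)); lra|easy].
      apply le_epsilon. intros eps He. apply E. lra.
    (* An exponent below s0 has eigenvalue above 1, so its measure cannot vanish. *)
    + apply Hg. intros t (s & Hs & -> & H0). simpl. apply Rnot_lt_le. intros L. revert H0.
      apply (hausdorff_measure_cantorE_nonzero m Hpos Hne s (lambda m s) (eigf m s 0) Hs); [| | |exact Hnd|].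
      * now apply eigf_bounds.
      * now apply eigf_at_0.
      * now apply eigf_eigen.
      * left. rewrite <- E0. now apply lambda_decreasing.
Qed.
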